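(* Let $X,Y$ be Hilbert spaces with $\dim X=\infty$, let $T\in\mathcal{B}(X,Y)$, and let $\{(X_n,T_n)\}_{n\in\mathbb{N}}$ be a least-squares projection approximation (LPA) for $T$. Then the following conditions are equivalent: (a) (Kernel Approximability) $\mathcal{N}(T)=\{x\in X:\lim_{n\to\infty}\mathrm{dist}(x,\mathcal{N}(T)\cap X_n)=0\}$, namely, $$\operatorname*{s-lim}_{n\to\infty}\mathcal{N}(T_n)=\operatorname*{w-\widetilde{lim}}_{n\to\infty}\mathcal{N}(T_n)=\mathcal{N}(T).$$ (b) (Inverse-graph Approximability) $$\operatorname*{s-lim}_{n\to\infty}\mathcal{G}(T_n^{\dagger})=\operatorname*{w-\widetilde{lim}}_{n\to\infty}\mathcal{G}(T_n^{\dagger})=\mathcal{G}(T^{\dagger}).$$ (c) (Bounded-weak Convergence) If a sequence $\{y_n\}\subseteq Y$ satisfies $\sup_n\|T_n^{\dagger}y_n\|<+\infty$ and $y_n\rightharpoonup y$ weakly in $Y$, then $y\in\mathcal{D}(T^{\dagger})$ and $T_n^{\dagger}y_n\rightharpoonup T^{\dagger}y$ weakly in $X$.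
   Context: $\mathcal{B}(X,Y)$ is the space of bounded linear operators from $X$ to $Y$. $\mathcal{D},\mathcal{N},\mathcal{R},\mathcal{G}$ denote domain, kernel, range and graph. $T^{\dagger}$ is the Moore-Penrose inverse of $T$: its domain is $\mathcal{D}(T^{\dagger})=\mathcal{R}(T)+\mathcal{R}(T)^{\perp}\subseteq Y$ and $T^{\dagger}y$ is the unique $x\in\mathcal{N}(T)^{\perp}$ with $Tx=P_{\overline{\mathcal{R}(T)}}\,y$. Its graph is $\mathcal{G}(T^{\dagger})=\{(y,T^\dagger y):y\in\mathcal{D}(T^\dagger)\}\subseteq Y\times X$. Products of Hilbert spaces carry the inner product $\langle(a_1,b_1),(a_2,b_2)\rangle=\langle a_1,a_2\rangle+\langle b_1,b_2\rangle$. $P_M$ is the orthogonal projection onto a closed subspace $M$. LPA: $\{X_n\}$ is a sequence of finite-dimensional subspaces of $X$ such that $P_{X_n}x\to x$ for every $x\in X$, and $T_n:=TP_{X_n}$ for all $n\in\mathbb{N}$. Each $T_n$ has finite rank, so $T_n^{\dagger}$ is bounded and defined on all of $Y$. For a sequence $\{S_n\}$ of nonempty subsets of a Banach space: $\operatorname*{s-lim}_{n\to\infty}S_n$ is the set of all $x$ for which there is a sequence $\{x_n\}$ with $x_n\in S_n$ and $x_n\to x$ in norm; $\operatorname*{w-\widetilde{lim}}_{n\to\infty}S_n$ is the set of all $x$ for which there is a sequence $\{x_n\}$ with $x_n\in\bigcup_{k=n}^{\infty}S_k$ for every $n$ and $x_n\rightharpoonup x$ weakly. *)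

(* Defs.v *)
From HB Require Import structures.
From mathcomp Require Import all_boot all_order all_algebra.
From mathcomp Require Import complex ring.
From mathcomp Require Import all_classical all_reals all_analysis.

Set Implicit Arguments.
Unset Strict Implicit.
Unset Printing Implicit Defensive.

Import Order.TTheory GRing.Theory Num.Theory.
Import numFieldNormedType.Exports.

Local Open Scope classical_set_scope.
Local Open Scope ring_scope.

Variant scalar_kind := RealScalars | ComplexScalars.

Definition scalar_field (R : realType) (k : scalar_kind) : numFieldType :=
  match k with
  | RealScalars => R
  | ComplexScalars => R[i]%C
  end.

Section Scalars.
Context {R : realType} {k : scalar_kind}.

Definition sconj : scalar_field R k -> scalar_field R k :=
  match k with
  | RealScalars => fun a => a
  | ComplexScalars => fun a => conjc a
  end.

Definition re : scalar_field R k -> R :=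
  match k with
  | RealScalars => fun a => a
  | ComplexScalars => fun a => complex.Re a
  end.

Definition of_real : R -> scalar_field R k :=
  match k with
  | RealScalars => fun a => a
  | ComplexScalars => fun a => a%:C%C
  end.

End Scalars.

Section ScalarMorphisms.
Variables (R : realType) (k : scalar_kind).

Lemma sconj_is_zmod : zmod_morphism (@sconj R k).
Proof. by rewrite /sconj; case: k => x y //=; rewrite rmorphB. Qed.

Lemma sconj_is_monoid : monoid_morphism (@sconj R k).
Proof.
case: k; split=> //.
- exact: (rmorph1 (@conjc R)).
- exact: (rmorphM (@conjc R)).
Qed.

HB.instance Definition _ :=
  GRing.isZmodMorphism.Build (scalar_field R k) (scalar_field R k) (@sconj R k) sconj_is_zmod.
HB.instance Definition _ :=
  GRing.isMonoidMorphism.Build (scalar_field R k) (scalar_field R k) (@sconj R k)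
    sconj_is_monoid.

Lemma of_real_is_zmod : zmod_morphism (@of_real R k).
Proof. by rewrite /of_real; case: k => x y //=; rewrite rmorphB. Qed.

Lemma of_real_is_monoid : monoid_morphism (@of_real R k).
Proof.
by case: k; split=> //; exact: (rmorphM (real_complex R)).
Qed.

HB.instance Definition _ :=
  GRing.isZmodMorphism.Build R (scalar_field R k) (@of_real R k) of_real_is_zmod.
HB.instance Definition _ :=
  GRing.isMonoidMorphism.Build R (scalar_field R k) (@of_real R k) of_real_is_monoid.

Lemma ler_of_real (a b : R) : (of_real a <= of_real b :> scalar_field R k) = (a <= b).
Proof. by rewrite /of_real; case: k => //=; rewrite lecR. Qed.

Lemma of_realK (a : R) : re (of_real a : scalar_field R k) = a.
Proof. by rewrite /re /of_real; case: k. Qed.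

Lemma sconj_of_real (a : R) : sconj (of_real a : scalar_field R k) = of_real a.
Proof. by rewrite /sconj /of_real; case: k => //=; rewrite oppr0. Qed.

Lemma re_ge0 (a : scalar_field R k) : 0 <= a -> of_real (re a) = a /\ 0 <= re a.
Proof.
rewrite /re /of_real; case: k a => //= -[a b].
by rewrite lecE /= => /andP[/eqP -> ->].
Qed.

End ScalarMorphisms.

(* [inner] is linear in its first argument and conjugate-linear in the second *)
HB.mixin Record NormedModule_isHilbert (R : realType) (k : scalar_kind) H
    & NormedModule (scalar_field R k) H := {
  inner : {dot H for @sconj R k} ;
  normr_inner : forall x : H, `|x| ^+ 2 = inner x x
}.

#[short(type="hilbertType")]
HB.structure Definition Hilbert (R : realType) (k : scalar_kind) :=
  {H of CompleteNormedModule (scalar_field R k) H & NormedModule_isHilbert R k H}.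

(* In the library [`|x|] lies in the scalar field, possibly [R[i]] *)
Definition rnorm (R : realType) (k : scalar_kind)
  (V : normedModType (scalar_field R k)) (x : V) : R := re `|x|.

Section RealNorm.
Variables (R : realType) (k : scalar_kind) (V : normedModType (scalar_field R k)).
Implicit Types x y : V.

Lemma of_real_rnorm x : of_real (rnorm x) = `|x|.
Proof. by have [] := re_ge0 (normr_ge0 x). Qed.

Lemma rnorm_ge0 x : 0 <= rnorm x.
Proof. by have [] := re_ge0 (normr_ge0 x). Qed.

Lemma ler_rnormD x y : rnorm (x + y) <= rnorm x + rnorm y.
Proof. by rewrite -(ler_of_real k) rmorphD /= !of_real_rnorm ler_normD. Qed.

End RealNorm.

Section HilbertProduct.
Variables (R : realType) (k : scalar_kind) (U V : hilbertType R k).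
Local Notation K := (scalar_field R k).

(* The library's normed module on [U * V] carries the max norm, hence the
   alias: [hprod] carries the norm of the sum of the inner products. *)
Definition hprod : Type := (U * V)%type.

HB.instance Definition _ := GRing.Lmodule.copy hprod (U * V)%type.

Definition hprod_norm (p : hprod) : K :=
  of_real (Num.sqrt (rnorm p.1 ^+ 2 + rnorm p.2 ^+ 2)).

Definition hprod_inner (p q : hprod) : K := inner p.1 q.1 + inner p.2 q.2.

Lemma hprod_normD p q : hprod_norm (p + q) <= hprod_norm p + hprod_norm q.
Proof.
rewrite /hprod_norm -rmorphD ler_of_real /=.
have := ler_rnormD p.1 q.1; have := ler_rnormD p.2 q.2.
have := rnorm_ge0 (p.1 + q.1); have := rnorm_ge0 (p.2 + q.2).
move: (rnorm_ge0 p.1) (rnorm_ge0 q.1) (rnorm_ge0 p.2) (rnorm_ge0 q.2).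
move: (rnorm p.1) (rnorm q.1) (rnorm p.2) (rnorm q.2).
move: (rnorm (p.1 + q.1)) (rnorm (p.2 + q.2)).
move=> s t a b c d a0 b0 c0 d0 t0 s0 hs ht.
have S0 : 0 <= a ^+ 2 + c ^+ 2 by rewrite addr_ge0 ?sqr_ge0.
have T0 : 0 <= b ^+ 2 + d ^+ 2 by rewrite addr_ge0 ?sqr_ge0.
rewrite -[leRHS]ger0_norm ?addr_ge0 ?sqrtr_ge0// -sqrtr_sqr.
apply: ler_wsqrtr; rewrite sqrrD !sqr_sqrtr//.
have : s ^+ 2 + t ^+ 2 <= (a + b) ^+ 2 + (c + d) ^+ 2.
  by apply: lerD; rewrite ler_sqr ?nnegrE ?addr_ge0.
move/le_trans; apply.
have : a * b + c * d <= Num.sqrt (a ^+ 2 + c ^+ 2) * Num.sqrt (b ^+ 2 + d ^+ 2).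
  rewrite -sqrtrM// -[leLHS]ger0_norm ?addr_ge0 ?mulr_ge0// -sqrtr_sqr.
  apply: ler_wsqrtr; rewrite -subr_ge0.
  have -> : (a ^+ 2 + c ^+ 2) * (b ^+ 2 + d ^+ 2) - (a * b + c * d) ^+ 2
            = (a * d - b * c) ^+ 2 by ring.
  exact: sqr_ge0.
set m := _ * Num.sqrt _ => hm.
rewrite -subr_ge0.
have -> : a ^+ 2 + c ^+ 2 + m *+ 2 + (b ^+ 2 + d ^+ 2) -
          ((a + b) ^+ 2 + (c + d) ^+ 2) = (m - (a * b + c * d)) *+ 2 by ring.
by rewrite mulrn_wge0// subr_ge0.
Qed.

Lemma hprod_norm_sqr p : hprod_norm p ^+ 2 = `|p.1| ^+ 2 + `|p.2| ^+ 2.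
Proof.
rewrite /hprod_norm -rmorphXn /= sqr_sqrtr ?addr_ge0 ?sqr_ge0//.
by rewrite rmorphD /= !rmorphXn /= !of_real_rnorm.
Qed.

Lemma hprod_norm_ge0 p : 0 <= hprod_norm p.
Proof. by rewrite -(rmorph0 (@of_real R k)) ler_of_real sqrtr_ge0. Qed.

Lemma hprod_normZ (a : K) (p : hprod) :
  hprod_norm (a *: p) = `|a| * hprod_norm p.
Proof.
apply/eqP; rewrite -(@eqrXn2 _ 2) ?mulr_ge0 ?hprod_norm_ge0//.
by rewrite exprMn !hprod_norm_sqr !normrZ !exprMn mulrDr.
Qed.

Lemma hprod_norm0_eq0 (p : hprod) : hprod_norm p = 0 -> p = 0.
Proof.
move=> p0; have /eqP := hprod_norm_sqr p.
rewrite p0 expr0n /= eq_sym paddr_eq0 ?exprn_ge0// !expf_eq0 /= !normr_eq0.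
by case: p {p0} => u v /= /andP[/eqP -> /eqP ->].
Qed.

HB.instance Definition _ := Lmodule_isNormed.Build K hprod
  hprod_normD hprod_normZ hprod_norm0_eq0.

Lemma hprod_normE (p : hprod) : `|p| = hprod_norm p.
Proof. by []. Qed.

Lemma ler_norm_fst (p : hprod) : `|p.1| <= `|p|.
Proof.
by rewrite -(@ler_pXn2r _ 2) ?nnegrE// [leRHS]hprod_norm_sqr lerDl exprn_ge0.
Qed.

Lemma ler_norm_snd (p : hprod) : `|p.2| <= `|p|.
Proof.
by rewrite -(@ler_pXn2r _ 2) ?nnegrE// [leRHS]hprod_norm_sqr lerDr exprn_ge0.
Qed.

Lemma ler_norm_hprod (p : hprod) : `|p| <= `|p.1| + `|p.2|.
Proof.
rewrite -(@ler_pXn2r _ 2) ?nnegrE ?addr_ge0// [leLHS]hprod_norm_sqr.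
by rewrite sqrrD addrAC lerDl mulrn_wge0 ?mulr_ge0.
Qed.

Lemma hprod_complete (F : set_system hprod) :
  ProperFilter F -> cauchy F -> cvg F.
Proof.
move=> FF /cauchy_ballP Fc.
have fst_cauchy : cauchy ((fun p : hprod => p.1) @ F).
  apply/cauchy_ballP => e e0.
  have [[A B] /= [FA FB] AB] := Fc e e0.
  exists ([set p.1 | p in A], [set p.1 | p in B]) => /=.
    by split; [apply: filterS FA|apply: filterS FB] => p; exists p.
  move=> [_ _] /= [[p Ap <-] [q Bq <-]].
  have := AB (p, q) (conj Ap Bq); rewrite -!ball_normE /=.
  by apply: le_lt_trans; exact: (ler_norm_fst (p - q)).
have snd_cauchy : cauchy ((fun p : hprod => p.2) @ F).
  apply/cauchy_ballP => e e0.
  have [[A B] /= [FA FB] AB] := Fc e e0.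
  exists ([set p.2 | p in A], [set p.2 | p in B]) => /=.
    by split; [apply: filterS FA|apply: filterS FB] => p; exists p.
  move=> [_ _] /= [[p Ap <-] [q Bq <-]].
  have := AB (p, q) (conj Ap Bq); rewrite -!ball_normE /=.
  by apply: le_lt_trans; exact: (ler_norm_snd (p - q)).
have /cvg_ex[u Fu] : cvg ((fun p : hprod => p.1) @ F) by exact: cauchy_cvg.
have /cvg_ex[v Fv] : cvg ((fun p : hprod => p.2) @ F) by exact: cauchy_cvg.
apply/cvg_ex; exists ((u, v) : hprod); apply/cvgrPdist_lt => e e0.
have e20 : 0 < e / 2 by rewrite divr_gt0.
move/cvgrPdist_lt : Fu => /(_ _ e20) Fu.
move/cvgrPdist_lt : Fv => /(_ _ e20) Fv.
near=> p; rewrite (le_lt_trans (ler_norm_hprod _))// (splitr e) ltrD//=.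
- by near: p.
- by near: p.
Unshelve. all: by end_near. Qed.

HB.instance Definition _ := Uniform_isComplete.Build hprod hprod_complete.

Lemma hprod_inner_bilinear : bilinear_for
  (GRing.Scale.Law.clone _ _ *%R _) (GRing.Scale.Law.clone _ _ (@sconj R k \; *%R) _)
  hprod_inner.
Proof.
split=> [q|p] a x y; rewrite /hprod_inner /=.
- by rewrite !linearPl /= mulrDr addrACA.
- by rewrite !linearPr /= mulrDr addrACA.
Qed.

HB.instance Definition _ := bilinear_isBilinear.Build K hprod hprod K _ _
  hprod_inner hprod_inner_bilinear.

Lemma hprod_inner_hermitian p q :
  hprod_inner p q = (-1) ^+ false * sconj (hprod_inner q p).
Proof.
rewrite /hprod_inner rmorphD /= mulrDr.
by congr (_ + _); exact: hermitian_subproof.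
Qed.

HB.instance Definition _ := isHermitianSesquilinear.Build K hprod false
  (@sconj R k) hprod_inner hprod_inner_hermitian.

Lemma hprod_normr_inner (p : hprod) : `|p| ^+ 2 = hprod_inner p p.
Proof. by rewrite [LHS]hprod_norm_sqr !normr_inner. Qed.

Lemma hprod_inner_gt0 (p : hprod) : p != 0 -> 0 < hprod_inner p p.
Proof. by move=> p0; rewrite -hprod_normr_inner exprn_gt0// normr_gt0. Qed.

HB.instance Definition _ := isDotProduct.Build K hprod hprod_inner
  hprod_inner_gt0.

HB.instance Definition _ := NormedModule_isHilbert.Build R k hprod
  hprod_normr_inner.

End HilbertProduct.

Section SetLimits.
Context {R : realType} {k : scalar_kind} {V : normedModType (scalar_field R k)}.

Definition weak_cvg (x_ : nat -> V) (x : V) : Prop :=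
  forall f : {linear V -> (scalar_field R k)^o},
    continuous f -> f (x_ n) @[n --> \oo] --> f x.

Definition s_lim (S : nat -> set V) : set V :=
  [set x | exists x_ : nat -> V,
    (forall n, S n (x_ n)) /\ x_ n @[n --> \oo] --> x].

Definition w_lim (S : nat -> set V) : set V :=
  [set x | exists x_ : nat -> V,
    (forall n, (\bigcup_(m >= n) S m) (x_ n)) /\ weak_cvg x_ x].

Definition dist (x : V) (M : set V) : R := inf [set rnorm (x - z) | z in M].

Definition fin_dim_subspace (M : set V) : Prop :=
  exists (d : nat) (e : 'I_d -> V),
    M = range (fun c : 'I_d -> scalar_field R k => \sum_i c i *: e i).

End SetLimits.

Section Orthogonality.
Context {R : realType} {k : scalar_kind} {H : hilbertType R k}.

Definition orth (M : set H) : set H :=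
  [set x | forall z, M z -> inner x z = 0].

(* Meaningful for a closed subspace [M] *)
Definition orth_proj (M : set H) (x : H) : H :=
  xget 0 [set m | M m /\ orth M (x - m)].

End Orthogonality.

Section MoorePenrose.
Context {R : realType} {k : scalar_kind} {X Y : hilbertType R k}.

Definition ker (T : X -> Y) : set X := T @^-1` [set 0].

Definition mp_dom (T : X -> Y) : set Y :=
  [set u + v | u in range T & v in orth (range T)].

(* A total function, equal to 0 outside [mp_dom T] *)
Definition mp_inv (T : X -> Y) (y : Y) : X :=
  xget 0 [set x | orth (ker T) x /\ T x = orth_proj (closure (range T)) y].

Definition mp_graph (T : X -> Y) : set (hprod Y X) :=
  [set (y, mp_inv T y) | y in mp_dom T].

Record LPA (T : X -> Y) (Xn : nat -> set X) (Tn : nat -> X -> Y) : Prop := {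
  LPA_fin_dim : forall n, fin_dim_subspace (Xn n) ;
  LPA_cvg : forall x, orth_proj (Xn n) x @[n --> \oo] --> x ;
  LPA_op : forall n, Tn n = T \o orth_proj (Xn n)
}.

End MoorePenrose.

(* Main.v *)
(* Let [P n] be the orthogonal projection onto [Xn n].  Since [ker (Tn n)] is the orthogonal sum of
   [ker T `&` Xn n] and the orthogonal complement of [Xn n], (a) says that every vector of [ker T]
   is a limit of vectors of [ker T `&` Xn n].  A pair [(y, x)] lies in the graph of [S^+] iff [x]
   is orthogonal to [ker S] and [y - S x] to the range of [S]; under (a) both conditions survive
   weak limits of pairs in the graphs of [Tn^+], and [(T (P n x) + (y - T x), P n x)] recovers
   [(y, x)] strongly, which is (b).  For (c), bounded sequences have weakly convergent subsequences,
   and (b) identifies their limits.  Finally (c) applied to [y_ n = Tn n u] with [u] in [ker T]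
   makes the component of [P n u] orthogonal to [ker T `&` Xn n] tend to 0 weakly, hence strongly
   because its squared norm is its inner product with [u]. *)
From HB Require Import structures.
Require Import Defs.
From mathcomp Require Import all_boot all_order all_algebra.
From mathcomp Require Import complex ring lra zify.
From mathcomp Require Import all_classical all_reals all_analysis.

Set Implicit Arguments.
Unset Strict Implicit.
Unset Printing Implicit Defensive.

Import Order.TTheory GRing.Theory Num.Theory.
Import numFieldNormedType.Exports.

Local Open Scope classical_set_scope.
Local Open Scope ring_scope.

(** * The real-valued modulus of a scalar *)

Section ScalarModulus.
Context {R : realType} {k : scalar_kind}.
Local Notation K := (scalar_field R k).
Implicit Types a b : K.

Definition sabs a : R := re `|a|.

Lemma of_real_sabs a : of_real (sabs a) = `|a|.
Proof. by have [] := re_ge0 (normr_ge0 a). Qed.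

Lemma of_real_inj : injective (@of_real R k).
Proof. exact: can_inj (@of_realK R k). Qed.

Lemma sabs_ge0 a : 0 <= sabs a.
Proof. by have [] := re_ge0 (normr_ge0 a). Qed.

Lemma sabs0 : sabs 0 = 0.
Proof. by apply: of_real_inj; rewrite of_real_sabs normr0 rmorph0. Qed.

Lemma sabsM a b : sabs (a * b) = sabs a * sabs b.
Proof. by apply: of_real_inj; rewrite rmorphM /= !of_real_sabs normrM. Qed.

Lemma sabsN a : sabs (- a) = sabs a.
Proof. by rewrite /sabs normrN. Qed.

Lemma ler_sabsD a b : sabs (a + b) <= sabs a + sabs b.
Proof. by rewrite -(ler_of_real k) rmorphD /= !of_real_sabs ler_normD. Qed.

Lemma sabs_eq0 a : sabs a = 0 -> a = 0.
Proof.
by move=> a0; apply/normr0_eq0; rewrite -of_real_sabs a0 rmorph0.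
Qed.

Lemma sabs_of_real (r : R) : sabs (of_real r : K) = `|r|.
Proof.
rewrite /sabs /re /of_real; case: k => //=.
by rewrite expr0n addr0 sqrtr_sqr.
Qed.

Lemma sconjM a b : sconj (a * b) = sconj a * sconj b.
Proof. exact: rmorphM. Qed.

Lemma of_realM (r s : R) : of_real (r * s) = of_real r * of_real s :> K.
Proof. exact: rmorphM. Qed.

Lemma of_realB (r s : R) : of_real (r - s) = of_real r - of_real s :> K.
Proof. exact: rmorphB. Qed.

Lemma of_realD (r s : R) : of_real (r + s) = of_real r + of_real s :> K.
Proof. exact: rmorphD. Qed.

Lemma of_real0 : of_real (0 : R) = 0 :> K.
Proof. exact: rmorph0. Qed.

Lemma mul_sconj a : a * sconj a = of_real (sabs a ^+ 2).
Proof.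
rewrite rmorphXn /= of_real_sabs /sconj; case: k a => a.
  by rewrite real_normK ?num_real// expr2.
exact/esym/(sqr_normc (a : R[i])).
Qed.

Lemma sabs_sconj a : sabs (sconj a) = sabs a.
Proof.
rewrite /sabs /sconj /re; case: k a => //= -[a b].
by rewrite /= sqrrN.
Qed.

End ScalarModulus.

(** * Norms, convergence and closure through real numbers *)

Section NormTheory.
Context {R : realType} {k : scalar_kind} {V : normedModType (scalar_field R k)}.
Local Notation K := (scalar_field R k).
Implicit Types x y : V.

Lemma rnorm0 : rnorm (0 : V) = 0.
Proof. by apply: (@of_real_inj R k); rewrite of_real_rnorm normr0 rmorph0. Qed.

Lemma rnormN x : rnorm (- x) = rnorm x.
Proof. by rewrite /rnorm normrN. Qed.

Lemma rnormBC x y : rnorm (x - y) = rnorm (y - x).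
Proof. by rewrite /rnorm distrC. Qed.

Lemma rnorm_eq0 x : rnorm x = 0 -> x = 0.
Proof. by move=> x0; apply/normr0_eq0; rewrite -of_real_rnorm x0 rmorph0. Qed.

Lemma rnormZ (a : K) x : rnorm (a *: x) = sabs a * rnorm x.
Proof.
apply: (@of_real_inj R k).
by rewrite rmorphM /= of_real_rnorm normrZ of_real_sabs of_real_rnorm.
Qed.

Lemma ler_rnormB x y : rnorm (x - y) <= rnorm x + rnorm y.
Proof. by rewrite -(rnormN y) ler_rnormD. Qed.

Lemma ler_rnormB_add x y z : rnorm (x - z) <= rnorm (x - y) + rnorm (y - z).
Proof. by have := ler_rnormD (x - y) (y - z); rewrite addrA subrK. Qed.

(** The positive elements of [K] are the images of the positive reals, also for complex scalars, so
    [K]-valued and real epsilons can be exchanged. *)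
Lemma cvg_rnormP (I : Type) (F : set_system I) {FF : Filter F} (f : I -> V) x :
  (f @ F --> x) <-> (rnorm (f i - x) @[i --> F] --> (0 : R)).
Proof.
split=> [/cvgrPdist_lt fx|fx].
  apply/cvgrPdist_lt => e e0.
  have e0' : 0 < (of_real e : K).
    by rewrite lt_def -(rmorph0 (@of_real R k)) ler_of_real ltW// andbT
      (inj_eq of_real_inj) gt_eqF.
  apply: filterS (fx _ e0') => i; rewrite distrC -of_real_rnorm sub0r normrN.
  rewrite ger0_norm ?rnorm_ge0// !lt_neqAle ler_of_real (inj_eq of_real_inj).
  exact.
apply/cvgrPdist_lt => e e0; move/cvgrPdist_lt : fx.
have [re0 re_ge] := re_ge0 (ltW e0).
have re_gt : 0 < re e.
  by rewrite lt_neqAle re_ge andbT; apply: contraTN e0 => /eqP e0;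
    rewrite -re0 -e0 rmorph0 ltxx.
move=> /(_ _ re_gt); apply: filterS => i.
rewrite sub0r normrN ger0_norm ?rnorm_ge0// distrC -of_real_rnorm -re0.
by rewrite of_realK !lt_neqAle ler_of_real (inj_eq of_real_inj).
Qed.

Lemma closure_rnormP (A : set V) x :
  closure A x <-> forall e : R, 0 < e -> exists2 z, A z & rnorm (x - z) < e.
Proof.
split=> [cAx e e0|Ax].
  have : nbhs x [set z | rnorm (z - x) < e].
    have /cvg_rnormP /cvgrPdist_lt/(_ _ e0) : id @ nbhs x --> x by [].
    by apply: filterS => z; rewrite sub0r normrN ger0_norm ?rnorm_ge0.
  by move=> /cAx[z [Az /= zx]]; exists z => //; rewrite rnormBC.
move=> B /nbhs_ballP[e /= e0]; have [ree re_ge] := re_ge0 (ltW e0).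
have re_gt : 0 < re e.
  by rewrite lt_neqAle re_ge andbT; apply: contraTN e0 => /eqP e0;
    rewrite -ree -e0 rmorph0 ltxx.
have [z Az zx] := Ax _ re_gt; move=> eB; exists z; split=> //; apply: eB.
rewrite -ball_normE /= -of_real_rnorm -ree.
by move: zx; rewrite !lt_neqAle ler_of_real (inj_eq of_real_inj).
Qed.

End NormTheory.

Lemma cvg_sabsP (R : realType) (k : scalar_kind) (I : Type) (F : set_system I)
    {FF : Filter F} (f : I -> scalar_field R k) a :
  (f @ F --> (a : (scalar_field R k)^o)) <->
  (sabs (f i - a) @[i --> F] --> (0 : R)).
Proof. exact: (@cvg_rnormP R k ((scalar_field R k)^o)). Qed.

Lemma squeeze_cvg0 (R : realType) (I : Type) (F : set_system I) {FF : Filter F}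
    (f g : I -> R) :
  (forall i, 0 <= f i <= g i) -> g @ F --> (0 : R) -> f @ F --> (0 : R).
Proof.
move=> fg g0; apply: (squeeze_cvgr _ (cvg_cst 0) g0).
exact: nearW.
Qed.

(** * Inner products and the Cauchy-Schwarz inequality *)

Section InnerProduct.
Context {R : realType} {k : scalar_kind} {H : hilbertType R k}.
Local Notation K := (scalar_field R k).
Implicit Types x y z : H.

Lemma innerC x y : inner x y = sconj (inner y x).
Proof. by rewrite (hermC (@inner R k H)) expr0 mul1r. Qed.

Lemma innerDl x y z : inner (x + y) z = inner x z + inner y z.
Proof. exact: linearDl. Qed.

Lemma innerBl x y z : inner (x - y) z = inner x z - inner y z.
Proof. exact: linearBl. Qed.

Lemma innerZl a x z : inner (a *: x) z = a * inner x z.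
Proof. exact: linearZl_LR. Qed.

Lemma inner0l z : inner (0 : H) z = 0.
Proof. exact: linear0l. Qed.

Lemma innerDr x y z : inner z (x + y) = inner z x + inner z y.
Proof. exact: linearDr. Qed.

Lemma innerBr x y z : inner z (x - y) = inner z x - inner z y.
Proof. exact: linearBr. Qed.

Lemma innerZr a x z : inner z (a *: x) = sconj a * inner z x.
Proof. exact: linearZr_LR. Qed.

Lemma inner0r z : inner z (0 : H) = 0.
Proof. exact: linear0r. Qed.

Lemma inner_eq0C x y : inner x y = 0 -> inner y x = 0.
Proof. by move=> xy; apply: sabs_eq0; rewrite innerC sabs_sconj xy sabs0. Qed.

Lemma innerxx x : inner x x = of_real (rnorm x ^+ 2).
Proof. by rewrite -normr_inner -of_real_rnorm rmorphXn. Qed.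

Lemma innerxx_eq0 x : inner x x = 0 -> x = 0.
Proof.
rewrite innerxx -(rmorph0 (@of_real R k)) => /of_real_inj/eqP.
by rewrite sqrf_eq0 => /eqP /rnorm_eq0.
Qed.

Lemma inner_eq x y : (forall z, inner x z = inner y z) -> x = y.
Proof.
move=> xy; apply/eqP; rewrite -subr_eq0; apply/eqP/innerxx_eq0.
by rewrite innerBl xy subrr.
Qed.

(** Pythagoras: the hypothesis makes [x - a *: z] orthogonal to [z]. Being free of division, it also
    covers [z = 0]. *)
Lemma sqr_rnormBZ x z (a : K) :
  inner x z = a * of_real (rnorm z ^+ 2) ->
  rnorm (x - a *: z) ^+ 2 = rnorm x ^+ 2 - sabs a ^+ 2 * rnorm z ^+ 2.
Proof.
move=> xz; apply: (@of_real_inj R k); rewrite -innerxx.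
rewrite innerBl !innerBr !innerZl !innerZr.
have -> : inner z x = sconj a * of_real (rnorm z ^+ 2).
  by rewrite innerC xz sconjM sconj_of_real.
rewrite xz !innerxx of_realB of_realM -mul_sconj.
ring.
Qed.

Lemma parallelogram x y :
  rnorm (x + y) ^+ 2 + rnorm (x - y) ^+ 2 =
  2 * rnorm x ^+ 2 + 2 * rnorm y ^+ 2.
Proof.
apply: (@of_real_inj R k); rewrite !of_realD !(of_realM 2) -!innerxx rmorph_nat.
rewrite !innerBl !innerDl !innerBr !innerDr.
ring.
Qed.

(** Comes from the nonnegative squared norm of [x] minus its projection on the line of [y]. *)
Lemma ler_sabs_inner x y : sabs (inner x y) <= rnorm x * rnorm y.
Proof.
have [->|y0] := eqVneq y 0.
  by rewrite inner0r sabs0 mulr_ge0 ?rnorm_ge0.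
have ny0 : rnorm y != 0 by apply: contra_neq y0; exact: rnorm_eq0.
have ny : 0 < rnorm y by rewrite lt_neqAle eq_sym ny0 rnorm_ge0.
have nyK : (of_real (rnorm y ^+ 2) : K) != 0.
  by rewrite -(rmorph0 (@of_real R k)) (inj_eq of_real_inj) sqrf_eq0.
pose a : K := inner x y / of_real (rnorm y ^+ 2).
have xy : inner x y = a * of_real (rnorm y ^+ 2) by rewrite /a divfK.
have := sqr_ge0 (rnorm (x - a *: y)).
rewrite sqr_rnormBZ// xy sabsM sabs_of_real ger0_norm ?sqr_ge0// subr_ge0.
rewrite -exprMn ler_sqr ?nnegrE ?mulr_ge0 ?sabs_ge0 ?rnorm_ge0// => ?.
by rewrite expr2 mulrA ler_pM2r.
Qed.

(* [b] is [a + w] or [a - w], with [w] the multiple of [x] of norm [r]. *)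
Lemma inner_large_nearby (a x : H) (r : R) : 0 <= r ->
  exists2 b, rnorm (b - a) <= r & r * rnorm x <= sabs (inner b x).
Proof.
move=> r0; have [->|x0] := eqVneq x 0.
  by exists a; rewrite ?subrr ?rnorm0 ?mulr0 ?sabs_ge0.
have nx0 : rnorm x != 0 by apply: contra_neq x0; exact: rnorm_eq0.
pose w : H := of_real (r / rnorm x) *: x.
have nw : rnorm w = r.
  by rewrite rnormZ sabs_of_real ger0_norm ?divfK// divr_ge0 ?rnorm_ge0.
have wx : inner w x = of_real (r * rnorm x).
  by rewrite innerZl innerxx -of_realM expr2 mulrA divfK.
have : 2 * (r * rnorm x) <= sabs (inner (a + w) x) + sabs (inner (a - w) x).
  rewrite -[sabs (inner (a - w) x)]sabsN.
  apply: le_trans (ler_sabsD _ _).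
  rewrite innerDl innerBl opprB addrC addrA subrK wx.
  rewrite -of_realD sabs_of_real mulr_natl mulr2n.
  exact: ler_norm.
have [aw _|aw] := leP (r * rnorm x) (sabs (inner (a + w) x)).
  by exists (a + w); rewrite // addrC addKr nw.
move=> ?; exists (a - w); last by lra.
by rewrite addrC addKr rnormN nw.
Qed.

(** Pairs weak with strong convergence: in [inner (f i) (g i - y) + inner (f i - x) y] the bound [C]
    controls the first term. *)
Lemma cvg_inner (I : Type) (F : set_system I) {FF : Filter F} (f g : I -> H)
    (x y : H) (C : R) :
  (forall v, sabs (inner (f i - x) v) @[i --> F] --> (0 : R)) ->
  (forall i, rnorm (f i) <= C) -> g @ F --> y ->
  sabs (inner (f i) (g i) - inner x y) @[i --> F] --> (0 : R).
Proof.
move=> fx fC /cvg_rnormP gy.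
have C0 i : 0 <= C := le_trans (rnorm_ge0 _) (fC i).
apply: (@squeeze_cvg0 _ _ _ _ _
  (fun i => C * rnorm (g i - y) + sabs (inner (f i - x) y))) => [i|].
  rewrite sabs_ge0 /=.
  have -> : inner (f i) (g i) - inner x y =
      inner (f i) (g i - y) + inner (f i - x) y.
    by rewrite innerBr innerBl addrA subrK.
  apply: le_trans (ler_sabsD _ _) _; rewrite lerD2r.
  apply: le_trans (ler_sabs_inner _ _) _.
  by rewrite ler_wpM2r ?rnorm_ge0.
rewrite -[X in _ --> X](addr0 (0 : R)) -{1}(mulr0 C); apply: cvgD => //.
by apply: cvgM => //; exact: cvg_cst.
Qed.

End InnerProduct.

Lemma cauchy_rnorm (R : realType) (k : scalar_kind)
    (V : completeNormedModType (scalar_field R k)) (u : nat -> V) :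
  (forall e : R, 0 < e ->
     exists N, forall m n, (N <= m)%N -> (N <= n)%N -> rnorm (u m - u n) < e) ->
  exists l : V, u @ \oo --> l.
Proof.
move=> uC; apply/cvg_ex; apply: cauchy_cvg; apply: cauchy_exP => e e0.
have [ree re_ge] := re_ge0 (ltW e0).
have re_gt : 0 < re e.
  by rewrite lt_neqAle re_ge andbT; apply: contraTN e0 => /eqP e0;
    rewrite -ree -e0 of_real0 ltxx.
have [N uN] := uC _ re_gt; exists (u N); exists N => // n /= Nn.
rewrite -ball_normE /= -of_real_rnorm -ree.
by have := uN N n (leqnn _) Nn; rewrite !lt_neqAle ler_of_real (inj_eq of_real_inj).
Qed.

Lemma linear_rnorm_bounded (R : realType) (k : scalar_kind)
    (V W : normedModType (scalar_field R k)) (f : {linear V -> W}) :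
  bounded_near f (nbhs (0 : V)) ->
  exists2 C : R, 0 <= C & forall x, rnorm (f x) <= C * rnorm x.
Proof.
move=> /linear_boundedP /pinfty_ex_gt0[r r0 fr].
have [rer re0] := re_ge0 (ltW r0); exists (re r) => // x.
by rewrite -(ler_of_real k) of_realM !of_real_rnorm rer.
Qed.

(** * Distance to a set *)

Section Distance.
Context {R : realType} {k : scalar_kind} {V : normedModType (scalar_field R k)}.
Implicit Types (x z : V) (M : set V).

Lemma dist_has_lbound x M : has_lbound [set rnorm (x - z) | z in M].
Proof. by exists 0 => _ [z _ <-]; exact: rnorm_ge0. Qed.

Lemma dist_le x M z : M z -> dist x M <= rnorm (x - z).
Proof. by move=> Mz; apply: (ge_inf (dist_has_lbound x M)); exists z. Qed.

Lemma dist_ge0 x M : 0 <= dist x M.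
Proof.
have [->|/set0P[z Mz]] := eqVneq M set0; first by rewrite /dist image_set0 inf0.
by apply: lb_le_inf => [|_ [y _ <-]]; [exists (rnorm (x - z)), z|exact: rnorm_ge0].
Qed.

Lemma dist_lt x M (r : R) : M !=set0 -> dist x M < r ->
  exists2 z, M z & rnorm (x - z) < r.
Proof.
move=> [z0 Mz0] /inf_lt[|_ [z Mz <-] zr]; last by exists z.
by exists (rnorm (x - z0)), z0.
Qed.

End Distance.

(** * Closed subspaces: projection theorem and Riesz representation *)

Definition lin_subspace (R : realType) (k : scalar_kind)
    (V : normedModType (scalar_field R k)) (M : set V) : Prop :=
  M 0 /\ forall a x y, M x -> M y -> M (a *: x + y).

Section Projection.
Context {R : realType} {k : scalar_kind} {H : hilbertType R k}.
Local Notation K := (scalar_field R k).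
Implicit Types (x y z : H) (L : set H).

(** A minimising sequence is Cauchy by the parallelogram law. At its limit [l], moving inside [L]
    cannot shorten [v - l], which forces orthogonality. *)
Lemma projection_theorem L v :
  lin_subspace L -> closure L `<=` L -> exists2 l, L l & orth L (v - l).
Proof.
move=> [L0 Llin] Lcl; pose d := dist v L.
have d0 : 0 <= d := dist_ge0 v L.
have /choice[l_ l_P] : forall n, exists z, L z /\ rnorm (v - z) ^+ 2 < d ^+ 2 + n.+1%:R^-1.
  move=> n; have [||z Lz vz] := @dist_lt _ _ _ v L (Num.sqrt (d ^+ 2 + n.+1%:R^-1)).
  - by exists 0.
  - rewrite -[ltLHS]ger0_norm// -sqrtr_sqr ltr_sqrt ?ltrDl ?invr_gt0//.
    by rewrite ltr_wpDl ?sqr_ge0 ?invr_gt0.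
  - exists z; split=> //; rewrite -[ltRHS]sqr_sqrtr ?addr_ge0 ?sqr_ge0//.
    by rewrite ltr_sqr ?nnegrE ?rnorm_ge0 ?sqrtr_ge0.
have lN e : 0 < e -> exists N, forall n, (N <= n)%N ->
    rnorm (v - l_ n) ^+ 2 < d ^+ 2 + e.
  move=> e0; exists (Num.truncn e^-1) => n Nn.
  apply: lt_le_trans (l_P n).2 _; rewrite lerD2l.
  rewrite -[leRHS]invrK lef_pV2 ?posrE ?invr_gt0//.
  apply: le_trans (ltW (truncnS_gt _)) _.
  by rewrite ler_nat ltnS.
have [l l_l] : exists l : H, l_ @ \oo --> l.
  apply: cauchy_rnorm => e e0.
  (* Two squared distances below [d ^+ 2 + e ^+ 2 / 4] leave less than [e ^+ 2] for the difference,
     once the sum has taken [4 * d ^+ 2]. *)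
  have e20 : 0 < e ^+ 2 / 4 by rewrite divr_gt0 ?exprn_gt0.
  have [N lN'] := lN _ e20; exists N => m n Nm Nn.
  rewrite -ltr_sqr ?nnegrE ?rnorm_ge0 ?(ltW e0)//.
  have := parallelogram (v - l_ n) (v - l_ m).
  have -> : v - l_ n - (v - l_ m) = l_ m - l_ n.
    by rewrite opprB [v - l_ n]addrC addrACA subrr addr0 addrC.
  have := lN' m Nm; have := lN' n Nn.
  (* The sum is twice the difference between [v] and the midpoint of [l_ n] and [l_ m], a point of
     [L]. *)
  have : 4 * d ^+ 2 <= rnorm (v - l_ n + (v - l_ m)) ^+ 2.
    have -> : v - l_ n + (v - l_ m) =
        of_real 2 *: (v - (of_real (2^-1) *: l_ n + of_real (2^-1) *: l_ m)).
      rewrite scalerBr scalerDr !scalerA -of_realM divff ?pnatr_eq0//.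
      rewrite (rmorph1 (@of_real R k)) !scale1r rmorph_nat scaler_nat mulr2n.
      by rewrite opprD addrACA.
    rewrite rnormZ sabs_of_real ger0_norm// exprMn.
    rewrite (_ : 2 ^+ 2 = 4); last by rewrite expr2 -natrM.
    rewrite ler_pM2l// ler_sqr ?nnegrE ?rnorm_ge0//; apply: dist_le.
    have := Llin (of_real (2^-1)) _ _ (l_P m).1 L0; rewrite addr0 => Lm.
    exact: Llin (l_P n).1 Lm.
  lra.
have Ll : L l.
  apply/Lcl/closure_rnormP => e e0.
  move/cvg_rnormP/cvgrPdist_lt/(_ _ e0) : l_l => [N _ /(_ _ (leqnn N))] /=.
  rewrite sub0r normrN ger0_norm ?rnorm_ge0// => lNl.
  by exists (l_ N); [exact: (l_P N).1|rewrite rnormBC].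
have vl : rnorm (v - l) ^+ 2 <= d ^+ 2.
  rewrite ler_sqr ?nnegrE ?rnorm_ge0//; apply/ler_addgt0Pr => e e0.
  have e20 : 0 < e / 2 by rewrite divr_gt0.
  have e220 : 0 < (e / 2) ^+ 2 by rewrite exprn_gt0.
  move/cvg_rnormP/cvgrPdist_lt/(_ _ e20) : l_l => [N1 _ lN1].
  have [N2 lN2] := lN _ e220.
  pose N := maxn N1 N2.
  have := lN1 N (leq_maxl _ _); rewrite /= sub0r normrN ger0_norm ?rnorm_ge0//.
  have vN : rnorm (v - l_ N) <= d + e / 2.
    rewrite -ler_sqr ?nnegrE ?rnorm_ge0 ?addr_ge0 ?(ltW e20)//.
    apply: le_trans (ltW (lN2 N (leq_maxr _ _))) _.
    by rewrite sqrrD addrAC lerDl mulrn_wge0// mulr_ge0// ltW.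
  have := ler_rnormB_add v (l_ N) l.
  lra.
exists l => // z Lz.
have [->|z0] := eqVneq z 0; first by rewrite inner0r.
have nz : 0 < rnorm z ^+ 2.
  rewrite exprn_gt0// lt_neqAle rnorm_ge0 andbT eq_sym.
  by apply: contra_neq z0; exact: rnorm_eq0.
have nzK : (of_real (rnorm z ^+ 2) : K) != 0.
  by rewrite -of_real0 (inj_eq of_real_inj) gt_eqF.
(* [a *: z] is the projection of [v - l] on the line of [z]. The competitor [l + a *: z] is no
   closer to [v] than [d], so Pythagoras gives [a = 0]. *)
pose a : K := inner (v - l) z / of_real (rnorm z ^+ 2).
have vlz : inner (v - l) z = a * of_real (rnorm z ^+ 2) by rewrite /a divfK.
have : d ^+ 2 <= rnorm (v - l - a *: z) ^+ 2.
  rewrite ler_sqr ?nnegrE ?rnorm_ge0// -addrA -opprD [l + _]addrC.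
  by apply/dist_le/Llin.
rewrite (sqr_rnormBZ vlz) => h.
have : sabs a ^+ 2 * rnorm z ^+ 2 <= 0 by lra.
rewrite pmulr_lle0// => a0; rewrite vlz (_ : a = 0) ?mul0r//.
by apply/sabs_eq0/eqP; rewrite -sqrf_eq0 eq_le a0 sqr_ge0.
Qed.

(** Both components of [x] with respect to [L] lie in [L]. This reduces weak limits to test vectors
    orthogonal to those already handled. *)
Lemma orth_split L x : lin_subspace L -> closure L `<=` L ->
  (forall y, orth L y -> L y) -> L x.
Proof.
move=> Ls Lcl oL; have [l Ll ol] := projection_theorem x Ls Lcl.
rewrite -(subrK l x) -[x - l]scale1r; apply: Ls.2 => //; exact: oL.
Qed.

(** The null space of [f] is closed; if it is proper, a vector [w] orthogonal to it represents [f]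
    up to a scalar, since [x - (f x / f w) *: w] lies in the null space. *)
Lemma Riesz (f : H -> K) (C : R) :
  (forall a x y, f (a *: x + y) = a * f x + f y) ->
  (forall x, sabs (f x) <= C * rnorm x) ->
  exists z, forall x, f x = inner x z.
Proof.
move=> flin fC.
have f0 : f 0 = 0.
  have := flin 1 0 0; rewrite scaler0 addr0 mul1r => /eqP.
  by rewrite eq_sym -subr_eq0 addrK => /eqP.
have fB x y : f (x - y) = f x - f y.
  by rewrite addrC -scaleN1r flin mulN1r addrC.
pose L : set H := [set x | f x = 0].
have Ls : lin_subspace L.
  by split=> // a x y; rewrite /L /= flin => -> ->; rewrite mulr0 addr0.
have Lcl : closure L `<=` L.
  move=> x /closure_rnormP Lx; apply/sabs_eq0/eqP; rewrite eq_le sabs_ge0 andbT.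
  apply/ler_addgt0Pr => e e0; rewrite add0r.
  (* [C] may be zero or negative; its absolute value plus one is a positive divisor. *)
  have C1 : 0 < `|C| + 1 by rewrite ltr_wpDl.
  have [|z Lz xz] := Lx (e / (`|C| + 1)); first exact: divr_gt0.
  rewrite -[f x]subr0 -Lz -fB; apply: le_trans (fC _) _.
  apply: le_trans (_ : (`|C| + 1) * rnorm (x - z) <= _).
    by rewrite ler_wpM2r ?rnorm_ge0// ler_wpDr// ler_norm.
  by rewrite mulrC -ler_pdivlMr// ltW.
have [fz|/existsNP[v fv]] := pselect (forall x, f x = 0).
  by exists 0 => x; rewrite fz inner0r.
have [l Ll ol] := projection_theorem v Ls Lcl.
pose w := v - l.
have fw : f w != 0 by rewrite fB Ll subr0; apply/eqP.
have nw : inner w w != 0.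
  by apply: contra_neq fw => /innerxx_eq0 ->.
(* The conjugate compensates for [inner] being conjugate-linear in its second argument. *)
exists (sconj (f w / inner w w) *: w) => x.
have sK (a : K) : sconj (sconj a) = a.
  by rewrite /sconj; case: k a => // a; exact: conjcK.
rewrite innerZr sK.
have : inner w (x - (f x / f w) *: w) = 0.
  by apply: ol; rewrite /L /= fB -[_ *: w]addr0 flin f0 addr0 divfK// subrr.
move/inner_eq0C; rewrite innerBl innerZl => /eqP; rewrite subr_eq0 => /eqP ->.
by rewrite mulrC mulrACA mulfV// mulr1 divfK.
Qed.

End Projection.

(** * Weak convergence and uniform boundedness *)

Section Weak.
Context {R : realType} {k : scalar_kind} {H : hilbertType R k}.
Local Notation K := (scalar_field R k).
Implicit Types (x y z v : H).

(** By Riesz every continuous functional is an inner product with a fixed vector; Cauchy-Schwarz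
    makes these functionals continuous. *)
Lemma weak_cvgP (x_ : nat -> H) x :
  weak_cvg x_ x <->
  forall v, sabs (inner (x_ n - x) v) @[n --> \oo] --> (0 : R).
Proof.
split=> [xx v|xx f fc].
  have lin : linear (fun y => inner y v : K^o).
    by move=> a y z; rewrite innerDl innerZl.
  pose f : {linear H -> K^o} :=
    HB.pack (fun y => inner y v : K^o) (GRing.isLinear.Build _ _ _ _ _ lin).
  have fc : continuous f.
    move=> y; apply/(@cvg_sabsP R k).
    apply: (@squeeze_cvg0 _ _ _ _ _ (fun z => rnorm (z - y) * rnorm v)).
      by move=> z; rewrite sabs_ge0 /= -innerBl; exact: ler_sabs_inner.
    rewrite -[X in _ --> X](mul0r (rnorm v)); apply: cvgM; last exact: cvg_cst.
    exact/cvg_rnormP.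
  have /(@cvg_sabsP R k) := xx f fc.
  by under eq_fun do rewrite /= -innerBl.
have /linear_rnorm_bounded[C _ fC] := continuous_linear_bounded (0 : H) (fc 0).
have [||z fz] := @Riesz R k H f C.
- by move=> a y z; rewrite linearP.
- by move=> y; have := fC y.
apply/(@cvg_sabsP R k); under eq_fun do rewrite !fz -innerBl.
exact: xx.
Qed.

(* Nested balls, as in Baire's theorem: the library's [Banach_Steinhauss] is over a [realType],
   which excludes complex scalars. *)
Lemma pointwise_bounded_bounded (x_ : nat -> H) :
  (forall v, exists B : R, forall n, sabs (inner v (x_ n)) <= B) ->
  exists C : R, forall n, rnorm (x_ n) <= C.
Proof.
move=> xB; apply: contrapT => xunb.
have {}xunb (C : R) : exists n, C < rnorm (x_ n).
  apply: contrapT => /forallNP xC; apply: xunb; exists C => n.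
  by rewrite leNgt; exact/negP.
(* [p] packs the stage, the centre and the radius of a ball. Positivity of the radius is an
   antecedent, so that the relation is total and [choice] applies. *)
have step (p : nat * (H * R)) : exists q : H * R, 0 < p.2.2 ->
    [/\ 0 < q.2, q.2 <= p.2.2 / 2, rnorm (q.1 - p.2.1) <= p.2.2 / 2 &
    forall v, rnorm (v - q.1) <= q.2 ->
      exists n, p.1%:R <= sabs (inner v (x_ n))].
  case: p => m [a r] /=.
  have [r0|r0] := ltP 0 r; last by exists (a, r); rewrite ltNge r0.
  have r20 : 0 < r / 2 by rewrite divr_gt0.
  (* At distance [r / 2] the inner product with [x_ n] can be made larger than [m%:R + 1]; moving by
     at most the inverse of [rnorm (x_ n)] then costs at most 1. *)
  have [n nx] := xunb ((m%:R + 1) / (r / 2)).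
  have nx0 : 0 < rnorm (x_ n).
    by apply: lt_trans nx; rewrite divr_gt0// ltr_wpDl.
  have [b ba bx] := inner_large_nearby a (x_ n) (ltW r20).
  exists (b, Num.min (r / 2) (rnorm (x_ n))^-1) => _ /=; split=> //.
  - by rewrite lt_min r20 invr_gt0.
  - by rewrite ge_min lexx.
  move=> v vb; exists n.
  have : rnorm (v - b) * rnorm (x_ n) <= 1.
    rewrite -ler_pdivlMr// mul1r; apply: le_trans vb _.
    by rewrite ge_min lexx orbT.
  have := ler_sabs_inner (v - b) (x_ n).
  have := ler_sabsD (inner v (x_ n)) (- inner (v - b) (x_ n)).
  rewrite sabsN innerBl opprB addrC subrK.
  by move: nx; rewrite ltr_pdivrMr// mulrC; lra.
have [f fP] := choice step.
pose fix s n : H * R := if n is m.+1 then f (m, s m) else (0, 1).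
have s0 n : 0 < (s n).2 by elim: n => //= n IH; have [] := fP (n, s n) IH.
have sP n := fP (n, s n) (s0 n).
have sle n : (s n).2 <= n.+1%:R^-1.
  elim: n => [|n IH]; first by rewrite invr1.
  have [_ /= + _ _] := sP n; move/le_trans; apply.
  apply: le_trans (_ : n.+1%:R^-1 / 2 <= _); first by rewrite ler_pM2r.
  by rewrite -invfM -natrM lef_pV2 ?posrE// ler_nat; lia.
(* Inclusion of closed balls, stated by centres and radii. *)
have snest n m : (n <= m)%N -> rnorm ((s m).1 - (s n).1) + (s m).2 <= (s n).2.
  elim: m => [|m IH]; first by rewrite leqn0 => /eqP ->; rewrite subrr rnorm0 add0r.
  rewrite leq_eqVlt => /predU1P[->|]; first by rewrite subrr rnorm0 add0r.
  rewrite ltnS => /IH nm; have [_ /= + + _] := sP m.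
  have := ler_rnormB_add (s m.+1).1 (s m).1 (s n).1.
  by rewrite /=; lra.
have [l sl] : exists l : H, (fun n => (s n).1) @ \oo --> l.
  apply: cauchy_rnorm => e e0; exists (Num.truncn (e / 2)^-1) => m n Nm Nn.
  set N := Num.truncn _ in Nm Nn.
  have := snest _ _ Nm; have := snest _ _ Nn; have := s0 m; have := s0 n.
  have : (s N).2 < e / 2.
    apply: le_lt_trans (sle N) _.
    rewrite -[ltRHS]invrK ltf_pV2 ?posrE ?invr_gt0 ?divr_gt0//.
    exact: truncnS_gt.
  have := ler_rnormB_add (s m).1 (s N).1 (s n).1.
  by rewrite [rnorm ((s N).1 - _)]rnormBC; lra.
have ls n : rnorm (l - (s n).1) <= (s n).2.
  apply/ler_addgt0Pr => e e0.
  move/cvg_rnormP/cvgrPdist_lt/(_ _ e0) : sl => [N _ /(_ _ (leq_maxl N n))] /=.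
  rewrite sub0r normrN ger0_norm ?rnorm_ge0// rnormBC => lN.
  have := snest _ _ (leq_maxr N n); have := s0 (maxn N n).
  have := ler_rnormB_add l (s (maxn N n)).1 (s n).1.
  by lra.
have [B lB] := xB l.
(* Stage [n] builds ball [n.+1], hence the shift: on this ball some inner product reaches
   [(Num.truncn B).+1], which exceeds [B]. *)
have [_ _ _ /(_ l (ls (Num.truncn B).+2))[n]] := sP (Num.truncn B).+1.
rewrite /= leNgt => /negP; apply.
exact: le_lt_trans (lB n) (truncnS_gt _).
Qed.

(** Convergent scalar sequences are bounded, so the uniform boundedness principle applies. *)
Lemma weak_cvg_bounded (x_ : nat -> H) x :
  weak_cvg x_ x -> exists C : R, forall n, rnorm (x_ n) <= C.
Proof.
move=> /weak_cvgP xx; apply: pointwise_bounded_bounded => v.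
have [|B [_ xB]] := @cvg_seq_bounded _ _ (fun n => sabs (inner (x_ n - x) v)).
  by apply/cvg_ex; exists 0; exact: xx.
exists (B + 1 + sabs (inner x v)) => n.
rewrite innerC sabs_sconj -{1}(subrK x (x_ n)) innerDl.
apply: le_trans (ler_sabsD _ _) _; rewrite lerD2r.
have B1 : B < B + 1 by rewrite ltrDl.
exact: le_trans (ler_norm _) (xB _ B1 n I).
Qed.

Lemma cvg_weak (x_ : nat -> H) x : x_ @ \oo --> x -> weak_cvg x_ x.
Proof. by move=> xx f fc; exact: continuous_cvg (fc x) xx. Qed.

(** The uniform bound on [f] lets a test vector be replaced by a nearby one with an error that does
    not depend on [i]; this gives closedness. *)
Lemma weak_test_closed (I : Type) (F : set_system I) {FF : Filter F}
    (f : I -> H) (C : R) (L := [set v | sabs (inner (f i) v) @[i --> F] --> (0 : R)]) :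
  (forall i, rnorm (f i) <= C) -> lin_subspace L /\ closure L `<=` L.
Proof.
move=> fC; split; first split.
- rewrite /L /=; under eq_fun do rewrite inner0r sabs0.
  exact: cvg_cst.
- move=> a v w Lv Lw; rewrite /L /=.
  apply: (@squeeze_cvg0 _ _ _ _ _
    (fun i => sabs a * sabs (inner (f i) v) + sabs (inner (f i) w))) => [i|].
    rewrite sabs_ge0 /= innerDr innerZr; apply: le_trans (ler_sabsD _ _) _.
    by rewrite sabsM sabs_sconj.
  rewrite -[X in _ --> X](addr0 (0 : R)) -{1}(mulr0 (sabs a)); apply: cvgD => //.
  by apply: cvgM => //; exact: cvg_cst.
- move=> v /closure_rnormP Lv; apply/cvgrPdist_lt => e e0.
  have C1 : 0 < `|C| + 1 by rewrite ltr_wpDl.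
  have [|w Lw vw] := Lv (e / 2 / (`|C| + 1)); first by rewrite !divr_gt0.
  have e20 : 0 < e / 2 by rewrite divr_gt0.
  move/cvgrPdist_lt/(_ _ e20) : Lw; apply: filterS => i.
  rewrite !sub0r !normrN !ger0_norm ?sabs_ge0// => fw.
  rewrite -(subrK w v) innerDr; apply: le_lt_trans (ler_sabsD _ _) _.
  rewrite (splitr e) ltr_leD ?(ltW fw)//; apply: le_lt_trans (ler_sabs_inner _ _) _.
  apply: le_lt_trans (_ : (`|C| + 1) * rnorm (v - w) < _).
    rewrite ler_wpM2r ?rnorm_ge0// ler_wpDr//.
    exact: le_trans (fC i) (ler_norm _).
  by rewrite mulrC -ltr_pdivlMr.
Qed.

End Weak.

(** * Limits along ultrafilters and weak sequential compactness *)

Lemma filter_cst_le0 (R : realType) (I : Type) (F : set_system I)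
    {FF : ProperFilter F} (c : R) (h : I -> R) :
  (forall i, c <= h i) -> h @ F --> (0 : R) -> c <= 0.
Proof.
move=> ch /cvgrPdist_lt h0; apply/ler_addgt0Pr => e e0.
have /filter_ex[i /=] := h0 _ e0; rewrite sub0r normrN add0r => hi.
exact: le_trans (ch i) (le_trans (ler_norm _) (ltW hi)).
Qed.

(** Compactness of the segment gives a cluster point, and an ultrafilter converges to each of its
    cluster points. *)
Lemma ultra_cvg_real (R : realType) (I : Type) (U : set_system I)
    {UU : UltraFilter U} (f : I -> R) (C : R) :
  (forall i, `|f i| <= C) -> exists a : R, f @ U --> a.
Proof.
move=> fC; have [|a [_ fa]] := @segment_compact R (- C) C (f @ U) _.
  by apply: nearW => i /=; rewrite in_itv /= -ler_norml.
exists a => B aB; have [//|UB] := in_ultra_setVsetC (f @^-1` B) UU.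
have [|r [/= nBr Br]] := fa (~` B) B _ aB; first exact: UB.
by [].
Qed.

Lemma ultra_cvg_scalar (R : realType) (k : scalar_kind) (I : Type)
    (U : set_system I) {UU : UltraFilter U} (f : I -> scalar_field R k) (C : R) :
  (forall i, sabs (f i) <= C) ->
  exists a, sabs (f i - a) @[i --> U] --> (0 : R).
Proof.
rewrite /sabs /re; case: k f => /= f fC.
  have [a fa] := ultra_cvg_real fC; exists a.
  by apply/norm_cvg0P/subr_cvg0.
have sqr_le (a b c : R) : Num.sqrt (a ^+ 2 + b ^+ 2) <= c -> `|a| <= c.
  by apply: le_trans; rewrite -sqrtr_sqr ler_wsqrtr// lerDl sqr_ge0.
have [a fa] : exists a : R, (fun i => complex.Re (f i)) @ U --> a.
  apply: (@ultra_cvg_real _ _ _ _ _ C) => i.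
  by have := fC i; case: (f i) => c d /=; exact: sqr_le.
have [b fb] : exists b : R, (fun i => complex.Im (f i)) @ U --> b.
  apply: (@ultra_cvg_real _ _ _ _ _ C) => i.
  by have := fC i; case: (f i) => c d /=; rewrite addrC; exact: sqr_le.
exists (a +i* b)%C.
apply: (@squeeze_cvg0 _ _ _ _ _
  (fun i => `|complex.Re (f i) - a| + `|complex.Im (f i) - b|)) => [i|].
  case: (f i) => c d /=; rewrite sqrtr_ge0 /=.
  rewrite -[leRHS]ger0_norm ?addr_ge0// -sqrtr_sqr ler_wsqrtr//.
  rewrite [leRHS]sqrrD !real_normK ?num_real// addrAC lerDl.
  by rewrite mulrn_wge0// mulr_ge0.
rewrite -[X in _ --> X](addr0 (0 : R)); apply: cvgD.
  by apply/norm_cvg0P/subr_cvg0.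
by apply/norm_cvg0P/subr_cvg0.
Qed.

Section WeakCompactness.
Context {R : realType} {k : scalar_kind} {H : hilbertType R k}.
Local Notation K := (scalar_field R k).
Implicit Types (x y z v : H).

(** The scalar limits define a bounded functional, linear because [v] is in the first slot; its
    Riesz vector is the weak limit. *)
Lemma weak_limit_of_scalar_limits (I : Type) (F : set_system I)
    {FF : ProperFilter F} (f : I -> H) (C : R) :
  (forall i, rnorm (f i) <= C) ->
  (forall v, exists a : K, sabs (inner v (f i) - a) @[i --> F] --> (0 : R)) ->
  exists x, forall v, sabs (inner (f i - x) v) @[i --> F] --> (0 : R).
Proof.
move=> fC /choice[phi phiP].
have [|v|x phix] := @Riesz R k H phi C.
- move=> a v w; apply/eqP; rewrite -subr_eq0; apply/eqP/sabs_eq0/eqP.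
  rewrite eq_le sabs_ge0 andbT.
  apply: (@filter_cst_le0 _ _ F _ _ (fun i =>
    sabs (inner (a *: v + w) (f i) - phi (a *: v + w)) +
    (sabs a * sabs (inner v (f i) - phi v) + sabs (inner w (f i) - phi w)))).
    move=> i; rewrite -sabsM -(sabsN (inner (a *: v + w) (f i) - _)).
    have -> : phi (a *: v + w) - (a * phi v + phi w) =
        - (inner (a *: v + w) (f i) - phi (a *: v + w)) +
        (a * (inner v (f i) - phi v) + (inner w (f i) - phi w)).
      by rewrite innerDl innerZl; ring.
    apply: le_trans (ler_sabsD _ _) _; rewrite lerD2l; exact: ler_sabsD.
  rewrite -[X in _ --> X](addr0 (0 : R)); apply: cvgD; first exact: phiP.
  rewrite -[X in _ --> X](addr0 (0 : R)) -{1}(mulr0 (sabs a)).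
  apply: cvgD; last exact: phiP.
  by apply: cvgM; [exact: cvg_cst|exact: phiP].
- rewrite -subr_le0; apply: (filter_cst_le0 _ (phiP v)) => i.
  have := ler_sabsD (inner v (f i)) (- (inner v (f i) - phi v)).
  rewrite sabsN opprB addrC subrK.
  have := ler_sabs_inner v (f i); have := ler_wpM2l (rnorm_ge0 v) (fC i).
  lra.
- exists x => v; have := phiP v; under eq_fun do rewrite phix -innerBr.
  by under eq_fun do rewrite innerC sabs_sconj.
Qed.

(* With [x] a weak limit along an ultrafilter, [s j] is chosen so that [x_ (s j) - x] is almost
   orthogonal to [x] and to the earlier terms; the test vectors [v] for which
   [inner (x_ (s j) - x) v] tends to 0 then form a closed subspace containing [x], the terms, and
   everything orthogonal to them. *)
Lemma bounded_weak_subseq (x_ : nat -> H) (C : R) (A : set nat) :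
  (forall n, rnorm (x_ n) <= C) ->
  (forall N, exists2 n, (N <= n)%N & A n) ->
  exists s x, (forall j, (j <= s j)%N /\ A (s j)) /\ weak_cvg (x_ \o s) x.
Proof.
move=> xC Ainf.
(* An ultrafilter refining this filter contains [A] and every tail of the indices. *)
have A_proper : ProperFilter (filter_from [set: nat] (fun N => [set n | (N <= n)%N /\ A n])).
  apply: filter_from_proper => [|N _]; last by have [n] := Ainf N; exists n.
  apply: filter_from_filter; first by exists 0%N.
  move=> M N _ _; exists (maxn M N) => // n /= [+ An].
  by rewrite geq_max => /andP[].
have [U [UU AU]] := ultraFilterLemma A_proper.
have UA N : U [set n | (N <= n)%N /\ A n] by apply: AU; exists N.
have [x xx] : exists x, forall v, sabs (inner (x_ n - x) v) @[n --> U] --> (0 : R).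
  apply: (weak_limit_of_scalar_limits xC) => v.
  apply: (@ultra_cvg_scalar R k nat U _ _ (rnorm v * C)) => n.
  exact: le_trans (ler_sabs_inner v (x_ n)) (ler_wpM2l (rnorm_ge0 v) (xC n)).
(* A finite list imposes finitely many conditions, each holding on a set of [U], so one index meets
   them all. The length of the list sets both the lower bound on the index and the precision. *)
have /choice[g gP] : forall l : seq H, exists n, [/\ (size l <= n)%N, A n &
    forall v, v \in l -> sabs (inner (x_ n - x) v) < (size l).+1%:R^-1].
  move=> l; suff /filter_ex[n [[? ?] ?]] : U ([set n | (size l <= n)%N /\ A n] `&`
      [set n | forall v, v \in l -> sabs (inner (x_ n - x) v) < (size l).+1%:R^-1]).
    by exists n.
  apply: filterI => //; move: (size l) => N.
  elim: l => [|v l IH]; first by apply: filterS (UA 0%N).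
  have N0 : 0 < N.+1%:R^-1 :> R by rewrite invr_gt0.
  move/cvgrPdist_lt/(_ _ N0) : (xx v) => xv.
  apply: filterS2 xv IH => n; rewrite sub0r normrN ger0_norm ?sabs_ge0// => nv nl w.
  by rewrite in_cons => /predU1P[->//|]; exact: nl.
pose fix L j : seq H := if j is m.+1 then x_ (g (L m)) :: L m else [:: x].
have sizeL j : size (L j) = j.+1 by elim: j => //= j ->.
have xL j : x \in L j by elim: j => [|j]; rewrite /= inE ?eqxx// => ->; rewrite orbT.
have sL i j : (i < j)%N -> x_ (g (L i)) \in L j.
  elim: j => // j IH; rewrite ltnS leq_eqVlt => /predU1P[->|/IH].
    by rewrite /= mem_head.
  by rewrite /= inE => ->; rewrite orbT.
exists (g \o L), x; split=> [j|].
  by have [+ + _] := gP (L j); rewrite sizeL => /ltnW.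
pose y j : H := x_ (g (L j)) - x.
have yC j : rnorm (y j) <= C + rnorm x.
  by apply: le_trans (ler_rnormB _ _) _; rewrite lerD2r.
have [Ls Lcl] := weak_test_closed (F := \oo) yC.
have test v : (exists N, forall j, (N <= j)%N -> v \in L j) ->
    sabs (inner (y j) v) @[j --> \oo] --> (0 : R).
  move=> [N vN]; apply/cvgrPdist_lt => e e0.
  exists (maxn N (Num.truncn e^-1)) => // j /=; rewrite geq_max => /andP[Nj ej].
  rewrite sub0r normrN ger0_norm ?sabs_ge0//.
  have [_ _ /(_ _ (vN j Nj))] := gP (L j); move/lt_trans; apply.
  rewrite sizeL -[ltRHS]invrK ltf_pV2 ?posrE ?invr_gt0//.
  by apply: lt_le_trans (truncnS_gt _) _; rewrite ler_nat ltnS leqW.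
(* A vector [w] orthogonal to all successful test vectors is orthogonal to [x] and to every chosen
   term, so its inner products with [y] vanish and it succeeds as well. *)
apply/weak_cvgP => v; apply: (orth_split v Ls Lcl) => w ow /=.
have wy j : inner (y j) w = 0.
  apply: inner_eq0C; rewrite innerBr !ow ?subrr//; apply: test.
    by exists 0%N.
  by exists j.+1 => i; exact: sL.
under eq_fun do rewrite wy sabs0.
exact: cvg_cst.
Qed.

End WeakCompactness.

(** * Orthogonal projections and finite-dimensional subspaces *)

Section OrthogonalProjection.
Context {R : realType} {k : scalar_kind} {H : hilbertType R k}.
Local Notation K := (scalar_field R k).
Implicit Types (x y z v : H) (M : set H).

(** Common interface for closed subspaces, through [projection_theorem], and for finite spans,
    through Gram-Schmidt. *)
Definition has_proj M : Prop := forall x, exists2 m, M m & orth M (x - m).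

(** Two candidates differ by a vector orthogonal to itself. *)
Lemma orth_projE M x m : M m -> orth M (x - m) -> orth_proj M x = m.
Proof.
move=> Mm om; apply: xget_subset1 => // a b [Ma oa] [Mb ob].
apply/eqP; rewrite -subr_eq0; apply/eqP/innerxx_eq0.
rewrite {1}(_ : a - b = (x - b) - (x - a)); last first.
  by rewrite opprB [RHS]addrC addrA subrK.
by rewrite innerBl !innerBr !oa// !ob// !subrr.
Qed.

Lemma orth_projP M x : has_proj M ->
  M (orth_proj M x) /\ orth M (x - orth_proj M x).
Proof. by move=> /(_ x)[m Mm om]; rewrite (orth_projE Mm om). Qed.

(** For [z] in [M] the squared norm of [x - m] equals [inner (x - m) (x - z)], which becomes
    arbitrarily small. *)
Lemma has_proj_closed M : has_proj M -> closure M `<=` M.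
Proof.
move=> Mp x /closure_rnormP Mx; have [m Mm om] := Mp x.
suff -> : x = m by [].
apply/eqP; rewrite -subr_eq0; apply/eqP/rnorm_eq0/eqP.
rewrite eq_le rnorm_ge0 andbT; apply/ler_addgt0Pr => e e0; rewrite add0r.
have [z Mz xz] := Mx _ e0.
have xmz : inner (x - m) (x - m) = inner (x - m) (x - z).
  by rewrite !innerBr !(om _ Mm) !(om _ Mz).
have := ler_sabs_inner (x - m) (x - z).
rewrite -xmz innerxx sabs_of_real ger0_norm ?sqr_ge0// expr2.
have [->|xm0] := eqVneq (rnorm (x - m)) 0; first by move=> _; exact: ltW.
rewrite ler_pM2l; last by rewrite lt_neqAle eq_sym xm0 rnorm_ge0.
by move/le_trans; apply; exact: ltW.
Qed.

Lemma orth_proj_inner M x y : has_proj M -> M x ->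
  inner x (orth_proj M y) = inner x y.
Proof.
move=> /(orth_projP y)[My oy] Mx; apply/eqP; rewrite -subr_eq0 -innerBr.
by rewrite -opprB -scaleN1r innerZr (inner_eq0C (oy x Mx)) mulr0.
Qed.

Lemma orth_proj_sym M x y : has_proj M ->
  inner (orth_proj M x) y = inner x (orth_proj M y).
Proof.
move=> Mp; rewrite -(orth_proj_inner y Mp (orth_projP x Mp).1).
by rewrite innerC (orth_proj_inner x Mp (orth_projP y Mp).1) -innerC.
Qed.

Lemma orth_proj_id M x : M x -> orth_proj M x = x.
Proof. by move=> Mx; apply: orth_projE => // z _; rewrite subrr inner0l. Qed.

Lemma orth_proj_linear M : lin_subspace M -> has_proj M ->
  linear (orth_proj M).
Proof.
move=> Ms Mp a x y; have [[Mx ox] [My oy]] := (orth_projP x Mp, orth_projP y Mp).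
apply: orth_projE; first exact: Ms.2.
move=> z Mz; rewrite opprD addrACA -scalerBr innerDl innerZl ox// oy//.
by rewrite mulr0 addr0.
Qed.

Lemma ler_rnorm_orth_proj M x : has_proj M -> rnorm (orth_proj M x) <= rnorm x.
Proof.
move=> Mp; have [->|p0] := eqVneq (rnorm (orth_proj M x)) 0.
  exact: rnorm_ge0.
have p_gt0 : 0 < rnorm (orth_proj M x) by rewrite lt_neqAle eq_sym p0 rnorm_ge0.
have := ler_sabs_inner (orth_proj M x) x.
rewrite -(orth_proj_inner x Mp (orth_projP x Mp).1).
by rewrite innerxx sabs_of_real ger0_norm ?sqr_ge0// expr2 ler_pM2l.
Qed.

(** A Gram-Schmidt step: project on [M] and on the line of the component [w] of [v] orthogonal to
    [M]. *)
Lemma has_proj_adjoin M v : lin_subspace M -> has_proj M ->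
  has_proj [set p.1 + p.2 *: v | p in M `*` [set: K]].
Proof.
move=> [M0 Ml] Mp x; have [[Px ox] [Pv ov]] := (orth_projP x Mp, orth_projP v Mp).
(* If [v] is in [M], then [w = 0] and division by zero gives [a = 0], still a correct
   coefficient. *)
pose w := v - orth_proj M v; pose a := inner x w / inner w w.
have Pxw : inner (orth_proj M x) w = 0 by apply: inner_eq0C; exact: ov.
exists (orth_proj M x + a *: w).
  exists (- a *: orth_proj M v + orth_proj M x, a); first by split; first exact: Ml.
  by rewrite /= /w scalerBr scaleNr [- _ + _]addrC addrA addrAC.
have orthM m : M m -> inner (x - (orth_proj M x + a *: w)) m = 0.
  move=> Mm; rewrite opprD addrA innerBl innerZl ox//.
  by rewrite (ov _ Mm) mulr0 subrr.
have orthw : inner (x - (orth_proj M x + a *: w)) w = 0.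
  have [->|w0] := eqVneq w 0; first by rewrite inner0r.
  rewrite opprD addrA !innerBl innerZl Pxw subr0 divfK ?subrr//.
  by apply: contra_neq w0; exact: innerxx_eq0.
move=> _ [[m c] [/= Mm _] <-].
rewrite /= (_ : c *: v = c *: orth_proj M v + c *: w); last first.
  by rewrite -scalerDr addrC subrK.
by rewrite !innerDr !innerZr (orthM _ Mm) (orthM _ Pv) orthw mulr0 !addr0.
Qed.

Lemma fin_dim_lin_subspace M : fin_dim_subspace M -> lin_subspace M.
Proof.
move=> [d [e ->]]; split.
  by exists (fun=> 0) => //; rewrite big1// => i _; rewrite scale0r.
move=> a _ _ [c _ <-] [c' _ <-]; exists (fun i => a * c i + c' i) => //.
rewrite scaler_sumr -big_split; apply: eq_bigr => i _ /=.
by rewrite scalerDl scalerA.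
Qed.

(** Induction on the length of a spanning family, possibly linearly dependent, adjoining its last
    vector. *)
Lemma fin_dim_has_proj M : fin_dim_subspace M -> has_proj M.
Proof.
move=> [d [e ->]] {M}; elim: d e => [|d IH] e.
  move=> x; exists 0; first by exists (fun=> 0) => //; rewrite big_ord0.
  by move=> _ [c _ <-]; rewrite big_ord0 inner0r.
pose e' (i : 'I_d) := e (widen_ord (leqnSn d) i).
pose M' : set H := range (fun c : 'I_d -> K => \sum_i c i *: e' i).
have M's : lin_subspace M' by apply: fin_dim_lin_subspace; exists d, e'.
suff -> : range (fun c : 'I_d.+1 -> K => \sum_i c i *: e i) =
    [set p.1 + p.2 *: e ord_max | p in M' `*` [set: K]].
  exact: has_proj_adjoin M's (IH e').
apply/seteqP; split=> [_ [c _ <-]|z [[m b] [/= [c _ <-] _] <-]].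
  exists (\sum_i c (widen_ord (leqnSn d) i) *: e' i, c ord_max); last first.
    by rewrite big_ord_recr.
  by split=> //; exists (fun i => c (widen_ord (leqnSn d) i)).
exists (fun i => if unlift ord_max i is Some j then c j else b) => //.
rewrite big_ord_recr /= unlift_none; congr (_ + _).
apply: eq_bigr => i _; rewrite (_ : widen_ord _ _ = lift ord_max i).
  by rewrite liftK /e'; congr (_ *: e _); apply: val_inj; rewrite /= /bump leqNgt ltn_ord.
by apply: val_inj; rewrite /= /bump leqNgt ltn_ord.
Qed.

End OrthogonalProjection.

(** * The Moore-Penrose inverse through orthogonality conditions *)

Section MoorePenroseTheory.
Context {R : realType} {k : scalar_kind} {X Y : hilbertType R k}.
Implicit Types (S : X -> Y) (x : X) (y : Y).

(** The least-squares solution of minimal norm. Both conditions are orthogonality relations, which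
    suits weak limits better than a projection on the closed range. *)
Definition mp_sol S y x : Prop := orth (ker S) x /\ orth (range S) (y - S x).

Lemma mp_sol_dom S y x : mp_sol S y x -> mp_dom S y.
Proof.
move=> [_ o]; exists (S x); first by exists x.
by exists (y - S x) => //; rewrite addrC subrK.
Qed.

Lemma orth_closure (H : hilbertType R k) (M : set H) : orth M `<=` orth (closure M).
Proof.
move=> x ox z /closure_rnormP Mz; apply/sabs_eq0/eqP; rewrite eq_le sabs_ge0 andbT.
apply/ler_addgt0Pr => e e0; rewrite add0r.
have x1 : 0 < rnorm x + 1 by rewrite ltr_wpDl ?rnorm_ge0.
have [|w Mw zw] := Mz (e / (rnorm x + 1)); first exact: divr_gt0.
rewrite -(subr0 (inner x z)) -(ox w Mw) -innerBr.
apply: le_trans (ler_sabs_inner _ _) _.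
apply: le_trans (_ : (rnorm x + 1) * rnorm (z - w) <= _).
  by rewrite ler_wpM2r ?rnorm_ge0// ler_wpDr.
by rewrite mulrC -ler_pdivlMr// ltW.
Qed.

(** An orthogonal residual makes [S x] the projection of [y] on the closed range; orthogonality to
    the kernel gives uniqueness. *)
Lemma mp_invE S y x : linear S -> mp_sol S y x -> mp_inv S y = x.
Proof.
move=> Sl [ox oy].
have SB a b : S (a - b) = S a - S b.
  by rewrite addrC -scaleN1r Sl scaleN1r addrC.
have projE : orth_proj (closure (range S)) y = S x.
  apply: orth_projE; last exact: orth_closure.
  by apply: subset_closure; exists x.
rewrite /mp_inv projE; apply: xget_subset1 => // a b [oa Sa] [ob Sb].
apply/eqP; rewrite -subr_eq0; apply/eqP/innerxx_eq0.
have kab : ker S (a - b) by rewrite /ker /= SB Sa Sb subrr.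
by rewrite {1}innerBl oa// ob// subrr.
Qed.

(** Existence of solutions ensures that [mp_inv] never falls back on its default value inside the
    domain. *)
Lemma mp_graphP S y x : linear S ->
  (forall y, mp_dom S y -> exists x, mp_sol S y x) ->
  mp_graph S (y, x) <-> mp_sol S y x.
Proof.
move=> Sl Sx; split=> [[y' dy' [<- <-]]|sx]; last first.
  by exists y; [exact: mp_sol_dom sx|rewrite (mp_invE Sl sx)].
by have [x' sx'] := Sx _ dy'; rewrite (mp_invE Sl sx').
Qed.

Lemma mp_sol_ex S y : linear S -> has_proj (ker S) -> mp_dom S y ->
  exists x, mp_sol S y x.
Proof.
move=> Sl kp [_ [u _ <-] [w ow <-]]; have [m km om] := kp u.
have SB a b : S (a - b) = S a - S b.
  by rewrite addrC -scaleN1r Sl scaleN1r addrC.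
by exists (u - m); split=> //; rewrite SB km subr0 addrC addKr.
Qed.

End MoorePenroseTheory.

(** * Weak limits: orthogonality, subsequences and products *)

Section Limits.
Context {R : realType} {k : scalar_kind}.

Lemma inner_lim_eq0 (H : hilbertType R k) (f g : nat -> H) (x y : H) (C : R) :
  (forall v, sabs (inner (f i - x) v) @[i --> \oo] --> (0 : R)) ->
  (forall i, rnorm (f i) <= C) -> g @ \oo --> y ->
  (forall i, inner (f i) (g i) = 0) -> inner x y = 0.
Proof.
move=> fx fC gy fg; apply/sabs_eq0/eqP; rewrite eq_le sabs_ge0 andbT.
apply: filter_cst_le0 (cvg_inner fx fC gy) => i.
by rewrite fg sub0r sabsN.
Qed.

Lemma cvg_index_infty (s : nat -> nat) :
  (forall n, (n <= s n)%N) -> s @ \oo --> \oo.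
Proof.
move=> sn A [N _ NA]; exists N => // n /= Nn; apply: NA.
exact: leq_trans Nn (sn n).
Qed.

Lemma s_lim_sub_w_lim (H : hilbertType R k) (S : nat -> set H) :
  s_lim S `<=` w_lim S.
Proof.
move=> x [x_ [Sx xx]]; exists x_; split; last exact: cvg_weak.
by move=> n; exists n => //=.
Qed.

Lemma weak_cvg_subseq (H : hilbertType R k) (x_ : nat -> H) x (s : nat -> nat) :
  (forall n, (n <= s n)%N) -> weak_cvg x_ x -> weak_cvg (x_ \o s) x.
Proof.
move=> sn xx f fc; exact: cvg_comp (cvg_index_infty sn) (xx f fc).
Qed.

Lemma weak_cvg_hprodP (U V : hilbertType R k) (p_ : nat -> hprod U V)
    (p : hprod U V) :
  weak_cvg p_ p <->
  weak_cvg (fun n => (p_ n).1) p.1 /\ weak_cvg (fun n => (p_ n).2) p.2.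
Proof.
have innerE (q r : hprod U V) : inner q r = inner q.1 r.1 + inner q.2 r.2 by [].
split=> [/weak_cvgP pp|[/weak_cvgP p1 /weak_cvgP p2]].
  split; apply/weak_cvgP => v.
    have := pp ((v, 0) : hprod U V); under eq_fun do rewrite innerE /= inner0r addr0.
    exact.
  have := pp ((0, v) : hprod U V); under eq_fun do rewrite innerE /= inner0r add0r.
  exact.
apply/weak_cvgP => v.
apply: (@squeeze_cvg0 _ _ _ _ _ (fun n => sabs (inner ((p_ n).1 - p.1) v.1) +
  sabs (inner ((p_ n).2 - p.2) v.2))) => [n|].
  by rewrite sabs_ge0 /= innerE ler_sabsD.
by rewrite -[X in _ --> X](addr0 (0 : R)); apply: cvgD.
Qed.

Lemma cvg_hprod (U V : hilbertType R k) (u_ : nat -> U) (v_ : nat -> V) u v :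
  u_ @ \oo --> u -> v_ @ \oo --> v ->
  (fun n => (u_ n, v_ n) : hprod U V) @ \oo --> ((u, v) : hprod U V).
Proof.
move=> /cvg_rnormP uu /cvg_rnormP vv; apply/cvg_rnormP.
apply: (@squeeze_cvg0 _ _ _ _ _ (fun n => rnorm (u_ n - u) + rnorm (v_ n - v))).
  move=> n; rewrite rnorm_ge0 /= -(ler_of_real k) of_realD !of_real_rnorm.
  exact: (ler_norm_hprod ((u_ n - u, v_ n - v) : hprod U V)).
by rewrite -[X in _ --> X](addr0 (0 : R)); apply: cvgD.
Qed.

End Limits.

(** * Kernels and inverse graphs of a least-squares projection approximation *)

Section LeastSquaresProjection.
Context {R : realType} {k : scalar_kind} {X Y : hilbertType R k}.
Variables (T : {linear X -> Y}) (Xn : nat -> set X) (Tn : nat -> X -> Y).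
Hypothesis T_bounded : bounded_near T (nbhs (0 : X)).
Hypothesis Tn_LPA : LPA T Xn Tn.

Local Notation P n := (orth_proj (Xn n)).
Local Notation N n := (ker T `&` Xn n).

Let Xn_lin n : lin_subspace (Xn n).
Proof. exact/fin_dim_lin_subspace/(LPA_fin_dim Tn_LPA). Qed.

Let Xn_proj n : has_proj (Xn n).
Proof. exact/fin_dim_has_proj/(LPA_fin_dim Tn_LPA). Qed.

Let P_in n x : Xn n (P n x).
Proof. exact: (orth_projP x (Xn_proj n)).1. Qed.

Let P_cvg x : P n x @[n --> \oo] --> x.
Proof. exact: (LPA_cvg Tn_LPA). Qed.

Let TnE n x : Tn n x = T (P n x).
Proof. by rewrite (LPA_op Tn_LPA). Qed.

Let PB n x y : P n (x - y) = P n x - P n y.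
Proof.
by rewrite addrC -scaleN1r (orth_proj_linear (Xn_lin n) (Xn_proj n)) scaleN1r addrC.
Qed.

Let Tn_linear n : linear (Tn n).
Proof.
by move=> a x y; rewrite !TnE (orth_proj_linear (Xn_lin n) (Xn_proj n)) linearP.
Qed.

Let T_cont : continuous T.
Proof. exact: bounded_linear_continuous. Qed.

Let kerT_lin : lin_subspace (ker T).
Proof.
split; first by rewrite /ker /= linear0.
by move=> a x y; rewrite /ker /= linearP => -> ->; rewrite scaler0 addr0.
Qed.

Let kerT_closed : closure (ker T) `<=` ker T.
Proof.
have [C C0 TC] := linear_rnorm_bounded T_bounded.
move=> x /closure_rnormP Tx; apply/rnorm_eq0/eqP; rewrite eq_le rnorm_ge0 andbT.
apply/ler_addgt0Pr => e e0; rewrite add0r.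
have C1 : 0 < C + 1 by rewrite ltr_wpDl.
have [|z Tz xz] := Tx (e / (C + 1)); first exact: divr_gt0.
rewrite -[T x]subr0 -Tz -linearB; apply: le_trans (TC _) _.
apply: le_trans (_ : (C + 1) * rnorm (x - z) <= _).
  by rewrite ler_wpM2r ?rnorm_ge0// ler_wpDr.
by rewrite mulrC -ler_pdivlMr// ltW.
Qed.

Let kerT_proj : has_proj (ker T).
Proof. by move=> x; exact: projection_theorem. Qed.

Let N_proj n : has_proj (N n).
Proof.
move=> x; apply: projection_theorem.
  split; first by split; [exact: kerT_lin.1|exact: (Xn_lin n).1].
  move=> a y z [Ty Xy] [Tz Xz]; split; first exact: kerT_lin.2.
  exact: (Xn_lin n).2.
by move=> y /closureI[/kerT_closed Ty /(has_proj_closed (Xn_proj n)) Xy].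
Qed.

Let adjoint z : exists w, forall x, inner (T x) z = inner x w.
Proof.
have [C C0 TC] := linear_rnorm_bounded T_bounded.
apply: (@Riesz _ _ _ (fun x => inner (T x) z) (C * rnorm z)).
  by move=> a x y; rewrite linearP innerDl innerZl.
move=> x; apply: le_trans (ler_sabs_inner _ _) _.
by rewrite mulrAC ler_wpM2r ?rnorm_ge0.
Qed.

Let weak_cvg_T (x_ : nat -> X) x : weak_cvg x_ x -> weak_cvg (T \o x_) (T x).
Proof.
move=> /weak_cvgP xx; apply/weak_cvgP => v; have [w Tw] := adjoint v.
by under eq_fun do rewrite /= -linearB Tw; exact: xx.
Qed.

(** Subtracting the component in [N n] does not change the image under [T]. The result lies in
    [Xn n], so its inner product with [v] in [ker (Tn n)] is that with [P n v], a vector of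
    [N n]. *)
Let mp_sol_Tn n u y : orth (range (Tn n)) (y - Tn n u) ->
  mp_sol (Tn n) y (P n u - orth_proj (N n) (P n u)).
Proof.
move=> oy; have [[Tq Xq] oq] := orth_projP (P n u) (N_proj n).
set q := orth_proj _ _ in Tq Xq oq *.
have Xx : Xn n (P n u - q).
  by rewrite addrC -scaleN1r; exact: (Xn_lin n).2.
split=> [v Tv|]; last by rewrite TnE (orth_proj_id Xx) linearB Tq subr0 -TnE.
rewrite -(orth_proj_inner v (Xn_proj n) Xx); apply: oq; split=> //.
by rewrite /ker /= -TnE.
Qed.

(** The images under [T] of a family spanning [Xn n] span the range of [Tn n], on which [y] can then
    be projected. *)
Let mp_sol_Tn_ex n y : exists x, mp_sol (Tn n) y x.
Proof.
have Rn : fin_dim_subspace (range (Tn n)).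
  have [d [e Xe]] := LPA_fin_dim Tn_LPA n; exists d, (T \o e).
  have Tsum (c : 'I_d -> scalar_field R k) :
      T (\sum_i c i *: e i) = \sum_i c i *: (T \o e) i.
    by rewrite linear_sum; apply: eq_bigr => i _; rewrite linearZ.
  apply/seteqP; split=> [_ [x _ <-]|_ [c _ <-]].
    have := P_in n x; rewrite {1}Xe => -[c _ cx].
    by exists c => //; rewrite TnE -cx Tsum.
  exists (\sum_i c i *: e i) => //; rewrite TnE orth_proj_id ?Tsum//.
  by rewrite Xe; exists c.
have [[u _ yu] oy] := orth_projP y (fin_dim_has_proj Rn).
by rewrite -yu in oy; exists (P n u - orth_proj (N n) (P n u)); exact: mp_sol_Tn.
Qed.

Let mp_graph_TnP n y x : mp_graph (Tn n) (y, x) <-> mp_sol (Tn n) y x.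
Proof. by apply: mp_graphP => // ? _; exact: mp_sol_Tn_ex. Qed.

Let mp_graph_TP y x : mp_graph T (y, x) <-> mp_sol T y x.
Proof.
apply: mp_graphP; first exact: linearP.
by move=> ?; apply: mp_sol_ex => //; exact: linearP.
Qed.

(** [x - P n x] lies in [ker (Tn n)], so it is orthogonal to [x]; it is also orthogonal to [P n x],
    hence zero. *)
Let mp_sol_Xn n y x : mp_sol (Tn n) y x -> P n x = x.
Proof.
move=> [ox _]; have kx : ker (Tn n) (x - P n x).
  by rewrite /ker /= TnE PB (orth_proj_id (P_in n x)) subrr linear0.
have [Px oP] := orth_projP x (Xn_proj n).
apply/esym/eqP; rewrite -subr_eq0; apply/eqP/innerxx_eq0.
by rewrite {1}innerBl (ox _ kx) sub0r (inner_eq0C (oP _ Px)) oppr0.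
Qed.

(** The sequential form of (a), a pivot between its two formulations. *)
Definition kernel_approximable :=
  forall u, ker T u -> exists2 u_ : nat -> X, (forall n, N n (u_ n)) & u_ @ \oo --> u.

(** Near-minimisers of the distance supply the sequence; vectors at vanishing distance stay in
    [ker T] because it is closed. *)
Lemma kernel_dist_approximable :
  ker T = [set x | dist x (N n) @[n --> \oo] --> (0 : R)] <-> kernel_approximable.
Proof.
split=> [kerE u Tu|kA].
  have : dist u (N n) @[n --> \oo] --> (0 : R) by move: Tu; rewrite {1}kerE.
  have /choice[u_ uP] : forall n, exists v, N n v /\
      rnorm (u - v) < dist u (N n) + n.+1%:R^-1.
    move=> n; have [||v Nv uv] := @dist_lt _ _ _ u (N n) (dist u (N n) + n.+1%:R^-1).
    - exists 0; split; [exact: kerT_lin.1|exact: (Xn_lin n).1].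
    - by rewrite ltrDl invr_gt0.
    - by exists v.
  move=> du; exists u_ => [n|]; first by have [] := uP n.
  apply/cvg_rnormP.
  apply: (@squeeze_cvg0 _ _ _ _ _ (fun n => dist u (N n) + n.+1%:R^-1)).
    by move=> n; rewrite rnorm_ge0 rnormBC ltW//; have [] := uP n.
  rewrite -[X in _ --> X](addr0 (0 : R)); apply: cvgD => //.
  exact: cvg_harmonic.
apply/seteqP; split=> [u /kA[u_ Nu /cvg_rnormP uu]|u /= du].
  apply: squeeze_cvg0 uu => n; rewrite dist_ge0/= rnormBC; exact: dist_le.
apply/kerT_closed/closure_rnormP => e e0.
move/cvgrPdist_lt/(_ _ e0) : du => [n _ /(_ n (leqnn n))] /=.
rewrite sub0r normrN ger0_norm ?dist_ge0// => /dist_lt[|v [Tv _] uv].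
  by exists 0; split; [exact: kerT_lin.1|exact: (Xn_lin n).1].
by exists v.
Qed.

(** Adding [u - P n u], which tends to 0, moves [N n] into [ker (Tn n)]; applying [P n] leads
    back. *)
Lemma s_lim_ker : kernel_approximable <-> ker T `<=` s_lim (fun n => ker (Tn n)).
Proof.
split=> [kA u /kA[u_ Nu uu]|kS u /kS[x_ [kx xu]]].
  exists (fun n => u_ n + (u - P n u)); split=> [n|].
    have [Tu Xu] := Nu n; rewrite /ker /= TnE.
    have -> : u_ n + (u - P n u) = u_ n - (P n u - u) by rewrite opprB.
    rewrite !PB (orth_proj_id Xu) (orth_proj_id (P_in n u)) subrr subr0.
    exact: Tu.
  rewrite -[X in _ --> X]addr0 -(subrr u); apply: cvgD => //.
  by apply: cvgB => //; exact: cvg_cst.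
exists (fun n => P n (x_ n)) => [n|].
  by split; [have := kx n; rewrite /ker /= TnE|exact: P_in].
move/cvg_rnormP : xu => xu; move/cvg_rnormP : (@P_cvg u) => Pu; apply/cvg_rnormP.
apply: (@squeeze_cvg0 _ _ _ _ _ (fun n => rnorm (x_ n - u) + rnorm (P n u - u))).
  move=> n; rewrite rnorm_ge0 /=; apply: le_trans (ler_rnormB_add _ (P n u) _) _.
  by rewrite -PB lerD2r ler_rnorm_orth_proj.
by rewrite -[X in _ --> X](addr0 (0 : R)); apply: cvgD.
Qed.

(** With [w] the adjoint image of [z], [inner x w] is the limit of inner products of [x_ n] with
    projections of [w], all zero because [Tn (s n) (x_ n) = 0]. *)
Lemma w_lim_ker : w_lim (fun n => ker (Tn n)) `<=` ker T.
Proof.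
move=> x [x_ [kx xx]].
(* The tail unions only provide some index [m >= n]; the chosen [s] tends to infinity but need not
   be monotone. *)
have /choice[s sP] : forall n, exists m, (n <= m)%N /\ ker (Tn m) (x_ n).
  by move=> n; have [m /= nm km] := kx n; exists m.
have [C xC] := weak_cvg_bounded xx.
apply: inner_eq => z; rewrite inner0l; have [w Tw] := adjoint z; rewrite Tw.
have sinf : s @ \oo --> \oo by apply: cvg_index_infty => n; have [] := sP n.
apply: (inner_lim_eq0 (f := x_) (g := fun n => P (s n) w)) xC _ _.
- exact/weak_cvgP.
- exact: (cvg_comp _ _ sinf (@P_cvg w)).
move=> n; rewrite -orth_proj_sym// -Tw -TnE; have [_ ->] := sP n.
exact: inner0l.
Qed.

Lemma w_lim_mp_graph : kernel_approximable ->
  w_lim (fun n => mp_graph (Tn n)) `<=` mp_graph T.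
Proof.
move=> kA [y x] [p_ [Gp /weak_cvg_hprodP[/= yy xx]]]; apply/mp_graph_TP.
have /choice[s sP] : forall n, exists m, (n <= m)%N /\ mp_sol (Tn m) (p_ n).1 (p_ n).2.
  move=> n; have [m /= nm km] := Gp n; exists m; split=> //.
  by apply/mp_graph_TnP; case: (p_ n) km.
have sinf : s @ \oo --> \oo by apply: cvg_index_infty => n; have [] := sP n.
(* Kernel approximability enters here: [u] is a strong limit of vectors of [ker (Tn (s n))], to
   which the second components are orthogonal. *)
split=> [u /kA[u_ Nu uu]|_ [z _ <-]].
  have [C xC] := weak_cvg_bounded xx.
  apply: (inner_lim_eq0 (f := fun n => (p_ n).2) (g := u_ \o s)) xC _ _.
  - exact/weak_cvgP.
  - exact: (cvg_comp _ _ sinf uu).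
  move=> n /=; have [_ [ox _]] := sP n; apply: ox.
  by have [Tu Xu] := Nu (s n); rewrite /ker /= TnE orth_proj_id.
(* The residuals are bounded and converge weakly; they are orthogonal to [Tn (s n) z], which tends
   strongly to [T z]. *)
have Txx := weak_cvg_T xx.
have [C1 yC] := weak_cvg_bounded yy; have [C2 TxC] := weak_cvg_bounded Txx.
apply: (inner_lim_eq0 (f := fun n => (p_ n).1 - T (p_ n).2)
  (g := fun n => T (P (s n) z)) (C := C1 + C2)).
- move=> v; apply: (@squeeze_cvg0 _ _ _ _ _ (fun n =>
    sabs (inner ((p_ n).1 - y) v) + sabs (inner (T (p_ n).2 - T x) v))) => [n|].
    rewrite sabs_ge0 /=.
    have -> : (p_ n).1 - T (p_ n).2 - (y - T x) =
        ((p_ n).1 - y) - (T (p_ n).2 - T x).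
      by rewrite !opprD !opprK addrACA.
    rewrite innerBl -[sabs (inner (T _ - _) _)]sabsN; exact: ler_sabsD.
  rewrite -[X in _ --> X](addr0 (0 : R)).
  move/weak_cvgP : yy => yy; move/weak_cvgP : Txx => Txx.
  by apply: cvgD; [exact: yy|exact: Txx].
- by move=> n; apply: le_trans (ler_rnormB _ _) _; exact: lerD (yC n) (TxC n).
- exact: (cvg_comp _ _ (cvg_comp _ _ sinf (@P_cvg z)) (@T_cont z)).
move=> n; have [_ sol] := sP n; have [_ oy] := sol; rewrite -TnE.
have <- : Tn (s n) (p_ n).2 = T (p_ n).2 by rewrite TnE (mp_sol_Xn sol).
by apply: oy; exists z.
Qed.

(* [x] orthogonal to [ker T] stays orthogonal to [N n] after projection to [Xn n], so the
   recovery sequence is [(T (P n x) + w, P n x)] with [w] the component of [y] orthogonal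
   to the range of [T]. *)
Lemma mp_graph_s_lim : mp_graph T `<=` s_lim (fun n => mp_graph (Tn n)).
Proof.
move=> [y x] /mp_graph_TP[ox oy].
exists (fun n => (T (P n x) + (y - T x), P n x)); split=> [n|].
  apply/mp_graph_TnP; split=> [v Tv|_ [z _ <-]].
    rewrite orth_proj_sym//; apply: ox.
    by rewrite /ker /= -TnE.
  by rewrite !TnE (orth_proj_id (P_in n x)) addrC addKr; apply: oy; exists (P n z).
apply: cvg_hprod; last exact: P_cvg.
rewrite -[X in _ --> X](subrK (T x) y) [X in _ --> X]addrC; apply: cvgD.
  exact: (cvg_comp _ _ (@P_cvg x) (@T_cont x)).
exact: cvg_cst.
Qed.

Definition bounded_weak_convergence := forall (y_ : nat -> Y) (y : Y),
  has_ubound (range (fun n => rnorm (mp_inv (Tn n) (y_ n)))) ->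
  weak_cvg y_ y ->
  mp_dom T y /\ weak_cvg (fun n => mp_inv (Tn n) (y_ n)) (mp_inv T y).

Lemma bounded_weak_of_graph :
  w_lim (fun n => mp_graph (Tn n)) = mp_graph T -> bounded_weak_convergence.
Proof.
move=> GT y_ y [C xC] yy; pose x_ n := mp_inv (Tn n) (y_ n).
have {}xC n : rnorm (x_ n) <= C by apply: xC; exists n.
have Gn n : mp_graph (Tn n) (y_ n, x_ n).
  by have [x sx] := mp_sol_Tn_ex n (y_ n); exists (y_ n) => //; exact: mp_sol_dom sx.
(* Along any infinite index set [A] a subsequence converges weakly. Its pairs belong to the tail
   unions of the graphs, so [GT] forces the limit [mp_inv T y], whatever [A] is. *)
have subseq A : (forall M, exists2 n, (M <= n)%N & A n) -> exists s : nat -> nat,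
    [/\ forall j, A (s j), mp_dom T y & weak_cvg (x_ \o s) (mp_inv T y)].
  move=> /(bounded_weak_subseq xC)[s [x [sA xx]]].
  have sn n : (n <= s n)%N := (sA n).1.
  have : mp_graph T (y, x).
    rewrite -GT; exists (fun n => (y_ (s n), x_ (s n))); split=> [n|].
      by exists (s n) => //; exact: sn.
    by apply/weak_cvg_hprodP; split=> //; exact: weak_cvg_subseq.
  move=> [y' dy [yE xE]]; exists s; rewrite -yE xE; split=> //.
  by move=> j; have [] := sA j.
have [|_ [_ dy _]] := subseq setT; first by move=> M; exists M.
split=> //; apply/weak_cvgP => v; apply/cvgrPdist_lt => e e0.
apply: contrapT => ncvg.
(* If convergence failed against [v], the bad indices would form an infinite set, and a subsequence
   inside it would still converge to the same limit. *)
have [|s [sA _ /weak_cvgP/(_ v)]] := subseq [set n | e <= sabs (inner (x_ n - mp_inv T y) v)].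
  move=> M; apply: contrapT => /forall2NP nM; apply: ncvg; exists M => // n /= Mn.
  rewrite sub0r normrN ger0_norm ?sabs_ge0// ltNge; apply/negP.
  by have [|] := nM n.
move=> /cvgrPdist_lt/(_ _ e0)[n _ /(_ n (leqnn n))] /=.
by rewrite sub0r normrN ger0_norm ?sabs_ge0// ltNge (sA n).
Qed.

Lemma kernel_of_bounded_weak : bounded_weak_convergence -> kernel_approximable.
Proof.
move=> bw u Tu; pose y_ n := Tn n u; pose q n := orth_proj (N n) (P n u).
have sol n : mp_sol (Tn n) (y_ n) (P n u - q n).
  by apply: mp_sol_Tn => z _; rewrite subrr inner0l.
have xE n : mp_inv (Tn n) (y_ n) = P n u - q n := mp_invE (Tn_linear n) (sol n).
have yy : weak_cvg y_ 0.
  apply: cvg_weak; rewrite -[X in _ --> X](_ : T u = 0)//.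
  rewrite (_ : y_ = (fun n => T (P n u))); last by apply/funext => n; rewrite /y_ TnE.
  exact: (cvg_comp _ _ (@P_cvg u) (@T_cont u)).
have T0 : mp_inv T 0 = 0.
  apply: mp_invE; first exact: linearP.
  split; first by move=> z _; exact: inner0l.
  by move=> z _; rewrite linear0 subr0; exact: inner0l.
have [|_] := bw y_ 0 _ yy.
  (* [P n u] and its projection [q n] both have norm at most [rnorm u]. *)
  exists (rnorm u + rnorm u) => _ [n _ <-]; rewrite xE.
  apply: le_trans (ler_rnormB _ _) _.
  have Pu := ler_rnorm_orth_proj u (Xn_proj n).
  by apply: lerD => //; apply: le_trans Pu; exact: ler_rnorm_orth_proj.
rewrite T0 => /weak_cvgP/(_ u); under eq_fun do rewrite xE subr0.
move=> xu; exists q => [n|]; first exact: (orth_projP _ (N_proj n)).1.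
(* [P n u - q n] lies in [Xn n], so [u] may be replaced by [P n u], and then the part [q n]
   contributes nothing. *)
have xu_sqr n : sabs (inner (P n u - q n) u) = rnorm (P n u - q n) ^+ 2.
  have [Nq oq] := orth_projP (P n u) (N_proj n).
  rewrite -(mp_sol_Xn (sol n)) orth_proj_sym// (mp_sol_Xn (sol n)).
  rewrite -[X in inner _ X](subrK (q n)) innerDr (oq _ Nq) addr0 innerxx.
  by rewrite sabs_of_real ger0_norm ?sqr_ge0.
have x0 : (fun n => P n u - q n) @ \oo --> (0 : X).
  apply/cvg_rnormP/cvgrPdist_lt => e e0.
  have e2 : 0 < e ^+ 2 by rewrite exprn_gt0.
  move/cvgrPdist_lt/(_ _ e2) : xu; apply: filterS => n.
  rewrite xu_sqr !sub0r !normrN subr0 !ger0_norm ?sqr_ge0 ?rnorm_ge0//.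
  by rewrite ltr_sqr ?nnegrE ?rnorm_ge0 ?(ltW e0).
rewrite (_ : q = (fun n => P n u - (P n u - q n))); last first.
  by apply/funext => n; rewrite opprB addrC subrK.
by rewrite -[X in _ --> X]subr0; apply: cvgB.
Qed.

End LeastSquaresProjection.

Theorem theorem1p1 (R : realType) (k : scalar_kind) (X Y : hilbertType R k)
    (T : {linear X -> Y}) (Xn : nat -> set X) (Tn : nat -> X -> Y) :
  ~ fin_dim_subspace [set: X] ->
  bounded_near T (nbhs (0 : X)) ->
  LPA T Xn Tn ->
  [<->
    (* kernel approximability, in its two forms *)
    ker T = [set x | dist x (ker T `&` Xn n) @[n --> \oo] --> (0 : R)];

    s_lim (fun n => ker (Tn n)) = w_lim (fun n => ker (Tn n)) /\
    w_lim (fun n => ker (Tn n)) = ker T;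

    (* inverse-graph approximability *)
    s_lim (fun n => mp_graph (Tn n)) = w_lim (fun n => mp_graph (Tn n)) /\
    w_lim (fun n => mp_graph (Tn n)) = mp_graph T;

    (* bounded-weak convergence *)
    forall (y_ : nat -> Y) (y : Y),
      has_ubound (range (fun n => rnorm (mp_inv (Tn n) (y_ n)))) ->
      weak_cvg y_ y ->
      mp_dom T y /\ weak_cvg (fun n => mp_inv (Tn n) (y_ n)) (mp_inv T y)].
Proof.
move=> _ Tb L; tfae.
(* Two inclusions carry the content: the weak limit set in the target, and the target in the strong
   one. The rest is [s_lim_sub_w_lim]. *)
- move=> /(kernel_dist_approximable Tb L)/(s_lim_ker L) ks.
  have wk := w_lim_ker Tb L; split; apply/seteqP; split=> //.
  + exact: s_lim_sub_w_lim.
  + by move=> x /wk/ks.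
  + by move=> x /ks; exact: s_lim_sub_w_lim.
- move=> [sw wk]; have kA : kernel_approximable T Xn.
    by apply/(s_lim_ker L); rewrite sw wk.
  have wG := w_lim_mp_graph Tb L kA; have Gs := mp_graph_s_lim Tb L.
  split; apply/seteqP; split=> //.
  + exact: s_lim_sub_w_lim.
  + by move=> p /wG/Gs.
  + by move=> p /Gs; exact: s_lim_sub_w_lim.
- by move=> [_ GT]; exact: (bounded_weak_of_graph Tb L GT).
- move=> bw; apply/(kernel_dist_approximable Tb L).
  exact: kernel_of_bounded_weak Tb L bw.
Qed.
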